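(* For a real Banach lattice $E$ the following statements are equivalent. (1) $E$ has the (d)-DP$^{*}$ property. (2) For every weak$^*$-null sequence $(f_n)$ in $E^\prime$, $(f_n)$ is an $L$-sequence and $|f_n|\to 0$ in the weak$^*$ topology. (3) Every bounded linear operator from $E$ into a Gelfand-Phillips space is DW-compact. (4) Every bounded linear operator $T:E\to c_0$ is DW-compact.
   Context: $E^\prime$ denotes the norm dual of $E$. For $A\subset E$, $Sol(A)=\{y\in E: |y|\le |x| \text{ for some } x\in A\}$. A bounded subset $A$ of $E$ is disjointly weakly compact if every disjoint sequence in $Sol(A)$ converges weakly to zero. A bounded linear operator $T$ from $E$ to a Banach space is DW-compact if $T(A)$ is relatively (norm) compact for each disjointly weakly compact $A\subset E$. A bounded subset $A$ of a Banach space $X$ is limited if every weak$^*$-null sequence $(f_n)\subset X^\prime$ converges uniformly to zero on $A$, i.e. $\sup_{x\in A}|f_n(x)|\to 0$. $E$ has the (d)-DP$^{*}$ property if every disjointly weakly compact subset of $E$ is limited. A Gelfand-Phillips space is a Banach space in which the classes of relatively compact sets and limited sets coincide. A bounded subset $B$ of the dual $X^\prime$ of a Banach space $X$ is an $L$-set if every weakly null sequence $(x_n)$ of $X$ converges uniformly to zero on $B$, i.e. $\sup_{f\in B}|f(x_n)|\to 0$. A sequence $(f_n)\subset X^\prime$ is an $L$-sequence if the set $\{f_n:n\in\mathbb{N}\}$ is an $L$-set in $X^\prime$. *)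

(* Defs.v *)
From HB Require Import structures.
From mathcomp Require Import all_boot all_order all_algebra.
From mathcomp Require Import all_classical all_reals all_analysis.

Set Implicit Arguments.
Unset Strict Implicit.
Unset Printing Implicit Defensive.

Import Order.TTheory GRing.Theory Num.Theory.
Import numFieldNormedType.Exports.

Local Open Scope classical_set_scope.
Local Open Scope ring_scope.

(* [Order.Lattice] cannot be joined with [CompleteNormedModule] here: HB would
   require the join of lattices and zmodules to have been declared before
   [realDomainType]. The structure therefore carries its own lattice order. *)
HB.mixin Record CompleteNormedModule_isBanachLattice (R : realType) E
    & CompleteNormedModule R E := {
  vle : E -> E -> Prop;
  vmeet : E -> E -> E;
  vjoin : E -> E -> E;
  vle_refl : forall x, vle x x;
  vle_anti : forall x y, vle x y -> vle y x -> x = y;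
  vle_trans : forall y x z, vle x y -> vle y z -> vle x z;
  vle_meet : forall x y z, vle x (vmeet y z) <-> vle x y /\ vle x z;
  vjoin_le : forall x y z, vle (vjoin x y) z <-> vle x z /\ vle y z;
  vleD2r : forall z x y, vle x y -> vle (x + z) (y + z);
  vleZ : forall (a : R) x y, 0 <= a -> vle x y -> vle (a *: x) (a *: y);
  vle_norm : forall x y,
    vle (vjoin x (- x)) (vjoin y (- y)) -> `|x| <= `|y|
}.

#[short(type="banachLatticeType")]
HB.structure Definition BanachLattice (R : realType) :=
  {E of CompleteNormedModule R E & CompleteNormedModule_isBanachLattice R E}.

Section c0_space.
Variable R : realType.

Definition c0_pred : {pred nat -> R} :=
  [pred u | `[< u n @[n --> \oo] --> (0 : R) >]].

Record c0 := C0 { c0_val :> nat -> R ; _ : c0_val \in c0_pred }.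

HB.instance Definition _ := [isSub for c0_val].
HB.instance Definition _ := [Choice of c0 by <:].

Lemma c0P (u : c0) : u n @[n --> \oo] --> (0 : R).
Proof. exact/asboolP/(valP u). Qed.

Lemma c0_submod_closed : submod_closed c0_pred.
Proof.
split; first by apply/asboolP; exact: cvg_cst.
move=> a u v /asboolP u0 /asboolP v0; apply/asboolP.
have -> : (0 : R) = a * 0 + 0 by rewrite mulr0 addr0.
by apply: cvgD => //; apply: cvgM => //; exact: cvg_cst.
Qed.

HB.instance Definition _ :=
  GRing.isSubmodClosed.Build _ _ c0_pred c0_submod_closed.
HB.instance Definition _ := [SubChoice_isSubLmodule of c0 by <:].

Definition c0_norm (u : c0) : R := sup (range (fun n => `|u n|)).

Lemma c0_has_sup (u : c0) : has_sup (range (fun n => `|u n|)).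
Proof.
split; first by exists `|u 0%N|, 0%N.
have uc : cvgn (u : nat -> R) by apply/cvg_ex; exists 0; exact: c0P.
have [M [_ uM]] := cvg_seq_bounded uc.
by exists (M + 1) => _ [n _ <-]; apply: uM; rewrite // ltrDl.
Qed.

Lemma c0_norm_ub (u : c0) n : `|u n| <= c0_norm u.
Proof. by apply: ub_le_sup; [case: (c0_has_sup u)|exists n]. Qed.

Lemma c0_norm_le (u : c0) M : (forall n, `|u n| <= M) -> c0_norm u <= M.
Proof.
by move=> uM; apply: ge_sup; [case: (c0_has_sup u)|move=> _ [n _ <-]].
Qed.

Lemma c0_ler_normD (u v : c0) : c0_norm (u + v) <= c0_norm u + c0_norm v.
Proof.
apply: c0_norm_le => n; apply: (le_trans (ler_normD (u n) (v n))).
by apply: lerD; exact: c0_norm_ub.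
Qed.

Lemma c0_normrZ (a : R) (u : c0) : c0_norm (a *: u) = `|a| * c0_norm u.
Proof.
have le b w : c0_norm (b *: w) <= `|b| * c0_norm w.
  apply: c0_norm_le => n; rewrite [X in `|X|]/(b * w n) normrM.
  by apply: ler_wpM2l => //; exact: c0_norm_ub.
apply/eqP; rewrite eq_le le /=.
have [->|a0] := eqVneq a 0.
  by rewrite normr0 mul0r (le_trans _ (c0_norm_ub _ 0%N)).
rewrite -ler_pdivlMl ?normr_gt0// -normfV.
by apply: le_trans (le _ _); rewrite scalerA mulVf// scale1r.
Qed.

Lemma c0_normr0_eq0 (u : c0) : c0_norm u = 0 -> u = 0.
Proof.
move=> u0; apply/val_inj/funext => n; apply/eqP.
by rewrite -normr_le0 -u0; exact: c0_norm_ub.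
Qed.

HB.instance Definition _ :=
  Lmodule_isNormed.Build R c0 c0_ler_normD c0_normrZ c0_normr0_eq0.

Lemma c0_dist_ub (u v : c0) n : `|u n - v n| <= `|u - v|.
Proof. exact: (c0_norm_ub (u - v) n). Qed.

Lemma c0_complete (F : set_system c0) : ProperFilter F -> cauchy F -> cvg F.
Proof.
move=> FF Fc.
have Fn n : cvg ((fun u : c0 => u n) @ F).
  apply: cauchy_cvg; apply/cauchyP => e e0.
  have /cauchyP/(_ e e0)[u uF] := Fc.
  exists (u n); change (F [set v : c0 | ball (u n) e (v n)]).
  apply: filterS uF => v; rewrite -!ball_normE /=.
  by apply: le_lt_trans; exact: (c0_dist_ub u v n).
pose l n := lim ((fun u : c0 => u n) @ F).
have Fl e : 0 < e ->
    \forall u \near (F : set_system c0), forall n, `|l n - (u : c0) n| <= e.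
  move=> e0; have e20 : 0 < e / 2 by rewrite divr_gt0.
  have /cauchyP/(_ _ e20)[w wF] := Fc.
  apply: filterS (wF) => u; rewrite -ball_normE /= => wu n.
  have lw : `|l n - w n| <= e / 2.
    have dl : `|v n - w n| @[v --> F] --> `|l n - w n|.
      by apply: cvg_norm; apply: cvgB; [exact: Fn|exact: cvg_cst].
    apply: (closed_cvg (fun x => x <= e / 2)) dl; first exact: closed_le.
    change (F [set v : c0 | `|v n - w n| <= e / 2]).
    apply: filterS wF => v; rewrite -ball_normE /= distrC => /ltW.
    by apply: le_trans; exact: (c0_dist_ub v w n).
  rewrite (splitr e) -(subrK (w n) (l n)) -addrA.
  apply: le_trans (ler_normD _ _) _; apply: lerD => //.
  by apply: le_trans (ltW wu); exact: (c0_dist_ub w u n).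
have l0 : l \in c0_pred.
  apply/asboolP/cvgr0Pnorm_le => e e0.
  have e20 : 0 < e / 2 by rewrite divr_gt0.
  have [u ul] := filter_ex (Fl _ e20).
  have /cvgr0Pnorm_le/(_ _ e20) := c0P u.
  apply: filterS => n un; rewrite -(subrK (u n) (l n)) (splitr e).
  by apply: le_trans (ler_normD _ _) _; apply: lerD.
apply/cvg_ex; exists (C0 l0); apply/cvgrPdist_le => e e0.
apply: filterS (Fl _ e0) => u ul; apply: c0_norm_le => n; exact: ul.
Qed.

HB.instance Definition _ := Uniform_isComplete.Build c0 c0_complete.

End c0_space.

Section banach_spaces.
Variable R : realType.

Record bounded_linear (X Y : normedModType R) := BoundedLinear {
  bounded_linear_fun :> {linear X -> Y};
  bounded_linearP : exists M, forall x, `|bounded_linear_fun x| <= M * `|x|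
}.

Definition dual (X : normedModType R) := bounded_linear X R^o.

(* In this definition, [limited] and [L_set], [sup] is taken over a set that is
   bounded above; on an empty index set it is 0. *)
Definition dual_norm (X : normedModType R) (f : dual X) : R :=
  sup [set `|f x| | x in [set x | `|x| <= 1]].

Definition weakly_null (X : normedModType R) (x : nat -> X) :=
  forall f : dual X, f (x n) @[n --> \oo] --> (0 : R).

Definition weak_star_null (X : normedModType R) (f : nat -> dual X) :=
  forall x : X, f n x @[n --> \oo] --> (0 : R).

Definition limited (X : normedModType R) (A : set X) :=
  bounded_set A /\
  forall f : nat -> dual X, weak_star_null f ->
    sup [set `|f n x| | x in A] @[n --> \oo] --> (0 : R).

Definition gelfand_phillips (X : completeNormedModType R) :=
  forall A : set X, precompact A <-> limited A.

Definition L_set (X : normedModType R) (B : set (dual X)) :=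
  [bounded dual_norm f | f in B] /\
  forall x : nat -> X, weakly_null x ->
    sup [set `|f (x n)| | f in B] @[n --> \oo] --> (0 : R).

Definition L_sequence (X : normedModType R) (f : nat -> dual X) :=
  L_set (range f).

End banach_spaces.

Section banach_lattices.
Variables (R : realType) (E : banachLatticeType R).

Definition vabs (x : E) : E := vjoin x (- x).

Definition disjoint_seq (x : nat -> E) :=
  forall m n, m != n -> vmeet (vabs (x m)) (vabs (x n)) = 0.

Definition Sol (A : set E) : set E :=
  [set y | exists2 x, A x & vle (vabs y) (vabs x)].

Definition disjointly_weakly_compact (A : set E) :=
  bounded_set A /\
  forall x : nat -> E, (forall n, Sol A (x n)) -> disjoint_seq x ->
    weakly_null x.

Definition DW_compact (Y : completeNormedModType R) (T : bounded_linear E Y) :=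
  forall A : set E, disjointly_weakly_compact A -> precompact (T @` A).

Definition d_DPstar :=
  forall A : set E, disjointly_weakly_compact A -> limited A.

Definition dual_le (f g : dual E) := forall x : E, vle 0 x -> f x <= g x.

(* [g] is |f|, the least upper bound of f and - f in the ordered space E'. *)
Definition dual_modulus (f g : dual E) :=
  [/\ dual_le f g,
      forall x : E, vle 0 x -> - f x <= g x
    & forall h : dual E, dual_le f h -> (forall x, vle 0 x -> - f x <= h x) ->
        dual_le g h].

End banach_lattices.
Arguments d_DPstar {R} E.

(* Main.v *)
(* (1) => (2).  The range of a weakly null sequence is disjointly weakly compact: if
   [w] is disjoint with [|w j| <= |x (k j)|] and [h >= 0], the components [p j] of [h]
   on the bands generated by the [w j] satisfy [\sum_j p j |y| <= h |y|], and a
   gliding hump argument gives [p j (x (k j)) --> 0], which dominates [h (w j)].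
   Order intervals are disjointly weakly compact too, and being limited they force
   the moduli [|f n|] to be weak* null.
   (2) => (1).  If [f n] does not tend to zero uniformly on [A], a subsequence of
   points of [A] is disjointified at small cost for the weak* null moduli; this gives
   a disjoint, hence weakly null, sequence of [Sol A] on which the [f n] do not tend
   uniformly to zero, against the L-sequence property.
   (1) => (3) holds because operators preserve limited sets, (3) => (4) because [c0]
   is a Gelfand-Phillips space, and (4) => (1) by applying (4) to the operator
   [x |-> (f n x)_n] into [c0]. *)
From HB Require Import structures.
Require Import Defs.
From mathcomp Require Import all_boot all_order all_algebra.
From mathcomp Require Import all_classical all_reals all_analysis.
From mathcomp Require Import ring lra.

Set Implicit Arguments.
Unset Strict Implicit.
Unset Printing Implicit Defensive.

Import Order.TTheory GRing.Theory Num.Theory.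
Import numFieldNormedType.Exports.

Local Open Scope classical_set_scope.
Local Open Scope ring_scope.

(** * Vector lattice calculus *)

Section vector_lattice.
Variables (R : realType) (E : banachLatticeType R).
Implicit Types (x y z a b c : E) (t : R).

Definition vpos x : E := vjoin x 0.

Let vscale_le t x y : 0 <= t -> vle x y -> vle (t *: x) (t *: y).
Proof. exact: vleZ. Qed.

Lemma vleD2rE z x y : vle (x + z) (y + z) <-> vle x y.
Proof.
split; last exact: vleD2r.
by move=> /(vleD2r (- z)); rewrite !addrK.
Qed.

Lemma vleD2lE z x y : vle (z + x) (z + y) <-> vle x y.
Proof. by rewrite ![z + _]addrC vleD2rE. Qed.

Lemma vleD a b x y : vle a x -> vle b y -> vle (a + b) (x + y).
Proof.
by move=> /(vleD2r b) ax /(vleD2lE x) bY; exact: vle_trans ax bY.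
Qed.

Lemma vle_subr x y z : vle x (z - y) <-> vle (x + y) z.
Proof. by rewrite -(vleD2rE y) subrK. Qed.

Lemma vle_subl x y z : vle (x - y) z <-> vle x (z + y).
Proof. by rewrite -(vleD2rE y) subrK. Qed.

Lemma vsub_ge0 x y : vle 0 (y - x) <-> vle x y.
Proof. by rewrite vle_subr add0r. Qed.

Lemma vleN x y : vle (- x) (- y) <-> vle y x.
Proof.
by split=> /vsub_ge0 h; apply/vsub_ge0; move: h; rewrite opprK addrC.
Qed.

Lemma vaddr_ge0 x y : vle 0 x -> vle 0 y -> vle 0 (x + y).
Proof. by move=> /vleD h /h; rewrite addr0. Qed.

Lemma vleDr x y : vle 0 y -> vle x (x + y).
Proof. by move=> y0; rewrite -{1}(addr0 x) vleD2lE. Qed.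

Lemma vleDl x y : vle 0 y -> vle x (y + x).
Proof. by rewrite addrC; exact: vleDr. Qed.

Lemma vscaler_ge0 t x : 0 <= t -> vle 0 x -> vle 0 (t *: x).
Proof. by move=> t0 /(vscale_le t0); rewrite scaler0. Qed.

Lemma vler_wscale s t x : s <= t -> vle 0 x -> vle (s *: x) (t *: x).
Proof.
by move=> st x0; apply/vsub_ge0; rewrite -scalerBl; apply: vscaler_ge0; rewrite ?subr_ge0.
Qed.

Lemma vsum_ge0 (I : eqType) (s : seq I) (F : I -> E) :
  (forall i, i \in s -> vle 0 (F i)) -> vle 0 (\sum_(i <- s) F i).
Proof.
elim: s => [|i s IH] F0; first by rewrite big_nil; exact: vle_refl.
rewrite big_cons; apply: vaddr_ge0; first by apply: F0; rewrite mem_head.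
by apply: IH => j js; apply: F0; rewrite inE js orbT.
Qed.

Lemma vle_sum_mem (I : eqType) (s : seq I) (F : I -> E) j :
  (forall i, vle 0 (F i)) -> j \in s -> vle (F j) (\sum_(i <- s) F i).
Proof.
move=> F0 js; rewrite (perm_big _ (perm_to_rem js)) big_cons.
by apply: vleDr; apply: vsum_ge0.
Qed.

Lemma vle_meetl x y : vle (vmeet x y) x.
Proof. by case/vle_meet: (vle_refl (vmeet x y)). Qed.

Lemma vle_meetr x y : vle (vmeet x y) y.
Proof. by case/vle_meet: (vle_refl (vmeet x y)). Qed.

Lemma vle_joinl x y : vle x (vjoin x y).
Proof. by case/vjoin_le: (vle_refl (vjoin x y)). Qed.

Lemma vle_joinr x y : vle y (vjoin x y).
Proof. by case/vjoin_le: (vle_refl (vjoin x y)). Qed.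

Lemma vmeetC x y : vmeet x y = vmeet y x.
Proof.
by apply: vle_anti; apply/vle_meet; split; by [exact: vle_meetl|exact: vle_meetr].
Qed.

Lemma vmeet_mono a b x y : vle a x -> vle b y -> vle (vmeet a b) (vmeet x y).
Proof.
move=> ax bY; apply/vle_meet; split.
  exact: vle_trans (vle_meetl _ _) ax.
exact: vle_trans (vle_meetr _ _) bY.
Qed.

Lemma vmeet_ge0 x y : vle 0 x -> vle 0 y -> vle 0 (vmeet x y).
Proof. by move=> x0 y0; apply/vle_meet. Qed.

Lemma vmeetD2r z x y : vmeet (x + z) (y + z) = vmeet x y + z.
Proof.
apply: vle_anti.
  apply/vle_subl/vle_meet.
  by split; apply/vle_subl; [exact: vle_meetl|exact: vle_meetr].
by apply/vle_meet; split; apply/vleD2rE; [exact: vle_meetl|exact: vle_meetr].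
Qed.

Lemma vmeetZ t x y : 0 < t -> vmeet (t *: x) (t *: y) = t *: vmeet x y.
Proof.
move=> t0; apply: vle_anti; last first.
  by apply/vle_meet; split; apply: vscale_le (ltW t0) _;
    [exact: vle_meetl|exact: vle_meetr].
rewrite -{1}[vmeet _ _](scalerKV (lt0r_neq0 t0)).
have tV : 0 <= t^-1 by rewrite invr_ge0 ltW.
apply: vscale_le (ltW t0) _; apply/vle_meet; split.
  have := vscale_le tV (vle_meetl (t *: x) (t *: y)).
  by rewrite [X in vle _ X]scalerK ?gt_eqF.
have := vscale_le tV (vle_meetr (t *: x) (t *: y)).
by rewrite [X in vle _ X]scalerK ?gt_eqF.
Qed.

Lemma vjoinE x y : vjoin x y = x + y - vmeet x y.
Proof.
apply: vle_anti.
  apply/vjoin_le; split; apply/vle_subr; first by apply/vleD2lE; exact: vle_meetr.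
  by rewrite addrC; apply/vleD2rE; exact: vle_meetl.
apply/vle_subl; rewrite [vjoin _ _ + _]addrC; apply/vle_subl/vle_meet.
split; apply/vle_subl; first by apply/vleD2lE; exact: vle_joinr.
by rewrite [X in vle X _]addrC; apply/vleD2lE; exact: vle_joinl.
Qed.

Lemma vjoinD2r z x y : vjoin (x + z) (y + z) = vjoin x y + z.
Proof. by rewrite !vjoinE vmeetD2r opprD addrACA addrK addrAC (addrAC x) addrAC. Qed.

Lemma vjoinZ t x y : 0 < t -> vjoin (t *: x) (t *: y) = t *: vjoin x y.
Proof. by move=> t0; rewrite !vjoinE vmeetZ// scalerBr scalerDr. Qed.

Lemma vpos_ge0 x : vle 0 (vpos x).
Proof. exact: vle_joinr. Qed.

Lemma vle_vpos x : vle x (vpos x).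
Proof. exact: vle_joinl. Qed.

Lemma vpos_le x y : vle x y -> vle 0 y -> vle (vpos x) y.
Proof. by move=> xy y0; apply/vjoin_le. Qed.

Lemma vpos_mono x y : vle x y -> vle (vpos x) (vpos y).
Proof.
by move=> xy; apply: vpos_le (vpos_ge0 y); exact: vle_trans xy (vle_vpos y).
Qed.

Lemma vposZ t x : 0 < t -> vpos (t *: x) = t *: vpos x.
Proof. by move=> t0; rewrite /vpos -{1}(scaler0 _ t) vjoinZ. Qed.

Lemma vposN x : vpos (- x) = - vmeet x 0.
Proof.
rewrite /vpos vjoinE addr0 -opprD; congr (- _).
by rewrite addrC -vmeetD2r addNr add0r vmeetC.
Qed.

Lemma vposBN x : vpos x - vpos (- x) = x.
Proof. by rewrite vposN opprK /vpos vjoinE addr0 subrK. Qed.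

Lemma vpos_meetN x : vmeet (vpos x) (vpos (- x)) = 0.
Proof.
have e : vpos x = x + vpos (- x) by rewrite -{2}(vposBN x) subrK.
by rewrite e -[X in vmeet _ X]add0r vmeetD2r vposN addrN.
Qed.

Lemma vabsE x : vabs x = vpos x + vpos (- x).
Proof.
have -> : vabs x = vjoin (2 *: x) (2 *: 0) - x.
  by rewrite /vabs -vjoinD2r scaler0 add0r scaler_nat mulr2n addrK.
rewrite vjoinZ// -/(vpos x) scaler_nat mulr2n -addrA; congr (_ + _).
by rewrite -{2}(vposBN x) opprB addrC subrK.
Qed.

Lemma vle_abs x : vle x (vabs x).
Proof. exact: vle_joinl. Qed.

Lemma vleN_abs x : vle (- x) (vabs x).
Proof. exact: vle_joinr. Qed.

Lemma vabs_le x y : vle x y -> vle (- x) y -> vle (vabs x) y.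
Proof. by move=> xy Nxy; apply/vjoin_le. Qed.

Lemma vabs_ge0 x : vle 0 (vabs x).
Proof. by rewrite vabsE; apply: vaddr_ge0; exact: vpos_ge0. Qed.

Lemma vabs_id x : vle 0 x -> vabs x = x.
Proof.
move=> x0; apply: vle_anti (vle_abs x); apply: vabs_le (vle_refl x) _.
by apply: vle_trans (x0); rewrite -oppr0; apply/vleN.
Qed.

Lemma vpos_le_abs x : vle (vpos x) (vabs x).
Proof. by apply: vpos_le (vle_abs x) (vabs_ge0 x). Qed.

Lemma norm_vabs x : `|vabs x| = `|x|.
Proof.
by apply/eqP; rewrite eq_le; apply/andP; split; apply: vle_norm;
  rewrite -![vjoin _ _]/(vabs _) (vabs_id (vabs_ge0 x)); exact: vle_refl.
Qed.

Lemma norm_vabs_le x y : vle (vabs x) y -> `|x| <= `|y|.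
Proof.
move=> xy; apply: vle_norm; rewrite -![vjoin _ _]/(vabs _).
exact: vle_trans xy (vle_abs y).
Qed.

Lemma norm_vle x y : vle 0 x -> vle x y -> `|x| <= `|y|.
Proof. by move=> x0 xy; apply: norm_vabs_le; rewrite vabs_id. Qed.

Lemma norm_vpos x : `|vpos x| <= `|x|.
Proof.
by rewrite -(norm_vabs x); apply: norm_vle; [exact: vpos_ge0|exact: vpos_le_abs].
Qed.

(** The first piece is [vmeet y a]. The remainder is below [b] because [y] lies below both [y + b]
    and [a + b], whose meet is [vmeet y a + b]. *)
Lemma riesz_decomposition y a b : vle 0 y -> vle y (a + b) -> vle 0 a -> vle 0 b ->
  exists y1 y2, [/\ y = y1 + y2, vle 0 y1 /\ vle y1 a & vle 0 y2 /\ vle y2 b].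
Proof.
move=> y0 yab a0 b0; exists (vmeet y a), (y - vmeet y a); split.
- by rewrite addrC subrK.
- by split; [exact: vmeet_ge0|exact: vle_meetr].
split; first by apply/vsub_ge0; exact: vle_meetl.
apply/vle_subl; rewrite addrC -vmeetD2r; apply/vle_meet; split=> //.
exact: vleDr.
Qed.

Lemma vmeet_eq0_le a b x y : vle 0 a -> vle 0 b -> vle a x -> vle b y ->
  vmeet x y = 0 -> vmeet a b = 0.
Proof.
move=> a0 b0 ax bY xy0; apply: vle_anti; last exact: vmeet_ge0.
by rewrite -xy0; exact: vmeet_mono.
Qed.

(** Riesz decomposition splits the meet into a piece below [a] and a piece below [b]. Both stay
    below [c], so both vanish. *)
Lemma vmeet_eq0D a b c : vle 0 a -> vle 0 b -> vle 0 c ->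
  vmeet a c = 0 -> vmeet b c = 0 -> vmeet (a + b) c = 0.
Proof.
move=> a0 b0 c0 ac bc.
have m0 : vle 0 (vmeet (a + b) c) by apply: vmeet_ge0 => //; exact: vaddr_ge0.
have mc := vle_meetr (a + b) c.
have [y1 [y2 [e [y10 y1a] [y20 y2b]]]] :=
  riesz_decomposition m0 (vle_meetl (a + b) c) a0 b0.
rewrite e in mc *.
have -> : y1 = 0.
  apply: vle_anti => //; rewrite -ac; apply/vle_meet; split=> //.
  exact: vle_trans (vleDr _ y20) mc.
have -> : y2 = 0.
  apply: vle_anti => //; rewrite -bc; apply/vle_meet; split=> //.
  exact: vle_trans (vleDl _ y10) mc.
by rewrite addr0.
Qed.

Lemma vmeet_eq0Z t a b : 0 <= t -> vle 0 a -> vle 0 b ->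
  vmeet a b = 0 -> vmeet (t *: a) b = 0.
Proof.
move=> t0 a0 b0 ab; have t1 : 0 < t + 1 by rewrite ltr_wpDl.
(* The factor [t + 1] is strictly positive, as [vmeetZ] requires, and dominates both [t] and [1]. *)
apply: (@vmeet_eq0_le _ _ ((t + 1) *: a) ((t + 1) *: b)) => //.
- exact: vscaler_ge0.
- by apply: vler_wscale; rewrite // lerDl.
- by rewrite -{1}(scale1r b); apply: vler_wscale; rewrite // lerDr.
- by rewrite vmeetZ// ab scaler0.
Qed.

(** For disjoint elements the sum is the join. *)
Lemma vadd_disjoint_le a b x : vmeet a b = 0 -> vle a x -> vle b x -> vle (a + b) x.
Proof.
by move=> ab ax bx; rewrite -(subr0 (a + b)) -ab -vjoinE; apply/vjoin_le.
Qed.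

Lemma vmeet_sum_eq0 (I : eqType) (s : seq I) (F : I -> E) c :
  vle 0 c -> (forall i, i \in s -> vle 0 (F i) /\ vmeet (F i) c = 0) ->
  vmeet (\sum_(i <- s) F i) c = 0.
Proof.
move=> c0; elim: s => [|i s IH] Fs.
  rewrite big_nil; apply: vle_anti (vle_meetl _ _) _.
  by apply: vmeet_ge0 => //; exact: vle_refl.
have Fs' j : j \in s -> vle 0 (F j) /\ vmeet (F j) c = 0.
  by move=> js; apply: Fs; rewrite inE js orbT.
have [Fi0 Fic] := Fs i (mem_head i s).
rewrite big_cons; apply: vmeet_eq0D => //; last exact: IH.
by apply: vsum_ge0 => j /Fs' [].
Qed.

Lemma vsum_disjoint_le (I : eqType) (s : seq I) (F : I -> E) x : uniq s -> vle 0 x ->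
  (forall i, i \in s -> vle 0 (F i) /\ vle (F i) x) ->
  (forall i j, i \in s -> j \in s -> i != j -> vmeet (F i) (F j) = 0) ->
  vle (\sum_(i <- s) F i) x.
Proof.
move=> + x0; elim: s => [|i s IH] /=; first by rewrite big_nil.
move=> /andP[is_ us] Fs Fd.
have Fs' j : j \in s -> vle 0 (F j) /\ vle (F j) x.
  by move=> js; apply: Fs; rewrite inE js orbT.
have [Fi0 Fix] := Fs i (mem_head i s).
rewrite big_cons; apply: vadd_disjoint_le => //.
  rewrite vmeetC; apply: vmeet_sum_eq0 => // j js; split; first by case: (Fs' j js).
  apply: Fd; rewrite ?mem_head// ?inE ?js ?orbT//.
  by apply: contraNneq is_ => <-.
by apply: IH => // j k js ks; apply: Fd; rewrite inE ?js ?ks orbT.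
Qed.

(** The negative part of [l] is below [vabs (u n - l)] as soon as [u n] is positive, so its norm is
    arbitrarily small. *)
Lemma vge0_closed (u : nat -> E) (l : E) :
  u n @[n --> \oo] --> l -> (\forall n \near \oo, vle 0 (u n)) -> vle 0 l.
Proof.
move=> ul u0; suff l0 : vpos (- l) = 0.
  by rewrite -(vposBN l) l0 subr0; exact: vpos_ge0.
apply/eqP; rewrite -normr_le0; apply/ler_addgt0Pl => e e0; rewrite addr0.
have /cvgrPdist_le/(_ _ e0) ule := ul.
have [n [un0 une]] := filter_ex (filterI u0 ule).
apply: le_trans une; rewrite distrC -(norm_vabs (u n - l)).
apply: norm_vle (vpos_ge0 _) _; apply: vpos_le (vabs_ge0 _).
by apply: vle_trans (vle_abs _); exact: vleDl.
Qed.

End vector_lattice.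

(** * Bounded functionals and their construction *)

Section dual_functionals.
Variables (R : realType) (X : normedModType R).
Implicit Types (f g : dual X) (x y : X).

Lemma dualD f x y : f (x + y) = (f x : R) + (f y : R).
Proof. exact: raddfD. Qed.

Lemma dualN f x : f (- x) = - (f x : R).
Proof. exact: raddfN. Qed.

Lemma dualB f x y : f (x - y) = (f x : R) - (f y : R).
Proof. exact: raddfB. Qed.

Lemma dualZ f a x : f (a *: x) = a * (f x : R).
Proof. exact: linearZ. Qed.

Lemma dual0 f : f 0 = 0 :> R.
Proof. exact: raddf0. Qed.

Lemma dual_sum f (I : Type) (s : seq I) (F : I -> X) :
  f (\sum_(i <- s) F i) = \sum_(i <- s) (f (F i) : R).
Proof. exact: raddf_sum. Qed.

Lemma dual_bound f : exists2 M : R, 0 <= M & forall x, `|f x : R| <= M * `|x|.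
Proof.
have [M fM] := bounded_linearP f; exists `|M| => // x.
by apply: le_trans (fM x) _; rewrite ler_wpM2r// ler_norm.
Qed.

Lemma mk_bounded_linear (Y : normedModType R) (F : X -> Y) M :
  (forall x y, F (x + y) = F x + F y) -> (forall a x, F (a *: x) = a *: F x) ->
  (forall x, `|F x| <= M * `|x|) -> exists g : bounded_linear X Y, forall x, g x = F x.
Proof.
move=> FD FZ FM.
have Flin : linear F by move=> a x y; rewrite FD FZ.
pose F' : {linear X -> Y} := HB.pack F (GRing.isLinear.Build _ _ _ _ _ Flin).
by exists (@BoundedLinear R X Y F' (ex_intro _ M FM)).
Qed.

Lemma mk_dual (F : X -> R) M :
  (forall x y, F (x + y) = F x + F y) -> (forall a x, F (a *: x) = a * F x) ->
  (forall x, `|F x| <= M * `|x|) -> exists g : dual X, forall x, g x = F x :> R.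
Proof. exact: (@mk_bounded_linear R^o). Qed.

End dual_functionals.

(** * Extension of functionals from the positive cone *)

Section cone_functionals.
Variables (R : realType) (E : banachLatticeType R).
Implicit Types (f g h : dual E) (x y z w : E).

(** Kantorovich extension: additivity makes [P x - P y] depend only on [x - y], so the value at the
    positive part minus the value at the negative part is linear. Both parts have norm at most that
    of the element, whence the factor 2 in the bound. *)
Lemma dual_cone_ext (P : E -> R) M :
  (forall x y, vle 0 x -> vle 0 y -> P (x + y) = P x + P y) ->
  (forall a x, 0 < a -> vle 0 x -> P (a *: x) = a * P x) ->
  (forall x, vle 0 x -> `|P x| <= M * `|x|) ->
  exists g : dual E, forall x, vle 0 x -> g x = P x :> R.
Proof.
move=> PD PZ PM.
pose F x := P (vpos x) - P (vpos (- x)).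
have PB x y : vle 0 x -> vle 0 y -> F (x - y) = P x - P y.
  move=> x0 y0; rewrite /F; have /(congr1 P) : x + vpos (- (x - y)) = vpos (x - y) + y.
    by apply/eqP; rewrite -subr_eq addrAC eq_sym -subr_eq vposBN.
  by rewrite !PD//; try exact: vpos_ge0; lra.
have F0 x : vle 0 x -> F x = P x.
  have P0 : P 0 = 0.
    have := PD 0 0 (vle_refl 0) (vle_refl 0); rewrite addr0 => /eqP.
    by rewrite -subr_eq0 opprD addNKr oppr_eq0 => /eqP.
  by move=> x0; rewrite -{1}(subr0 x) PB ?P0 ?subr0//; exact: vle_refl.
have FD x y : F (x + y) = F x + F y.
  rewrite -{1}(vposBN x) -{1}(vposBN y) addrACA -opprD PB; last 2 first.
  - by apply: vaddr_ge0; exact: vpos_ge0.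
  - by apply: vaddr_ge0; exact: vpos_ge0.
  by rewrite !PD; try exact: vpos_ge0; rewrite opprD addrACA.
have FN x : F (- x) = - F x by rewrite /F opprK opprB.
have FZp a x : 0 < a -> F (a *: x) = a * F x.
  by move=> a0; rewrite /F -scalerN !vposZ// !PZ ?mulrBr//; exact: vpos_ge0.
have FZ a x : F (a *: x) = a * F x.
  have [a0|a0|->] := ltgtP a 0; last 2 first.
  - exact: FZp.
  - by rewrite scale0r mul0r -(subr0 0) PB ?subrr//; exact: vle_refl.
  by rewrite -[a]opprK scaleNr FN FZp ?oppr_gt0// !mulNr opprK.
have FM x : `|F x| <= (`|M| *+ 2) * `|x|.
  have PMv z : `|P (vpos z)| <= `|M| * `|z|.
    apply: le_trans (PM _ (vpos_ge0 _)) _.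
    apply: le_trans (ler_wpM2r (normr_ge0 _) (ler_norm M)) _.
    by apply: ler_wpM2l; rewrite ?norm_vpos.
  apply: le_trans (ler_normB _ _) _; rewrite mulrnAl mulr2n; apply: lerD => //.
  by rewrite -[`|x|]normrN.
have [g gE] := mk_dual FD FZ FM.
by exists g => x x0; rewrite gE F0.
Qed.

End cone_functionals.

(** * Functionals restricted to ideals, and the modulus *)

Section ideals.
Variables (R : realType) (E : banachLatticeType R).
Implicit Types (f g h : dual E) (x y z w : E).

(** An order ideal as seen on the positive cone: a cone that is hereditary for positive elements. *)
Definition positive_ideal (I : set E) :=
  [/\ I 0, forall x y, I x -> I y -> I (x + y),
      forall t x, 0 <= t -> I x -> I (t *: x)
    & forall x y, vle 0 x -> vle x y -> I y -> I x].

(** Riesz-Kantorovich formula: [p x] is the supremum of [f] over the elements of [I] between [0] and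
    [x]. Additivity comes from Riesz decomposition, whose pieces stay in [I] by heredity. The whole
    space yields the positive part of [f]; the ideal generated by one element yields a component. *)
Lemma ideal_functional f (I : set E) : positive_ideal I ->
  exists p : dual E, forall x, vle 0 x ->
    (forall y, vle 0 y -> vle y x -> I y -> (f y : R) <= p x) /\
    (forall c : R, (forall y, vle 0 y -> vle y x -> I y -> (f y : R) <= c) ->
      (p x : R) <= c).
Proof.
move=> [I0 ID IZ Idown]; have [M M0 fM] := dual_bound f.
pose S x := [set (f y : R) | y in [set y | [/\ vle 0 y, vle y x & I y]]].
pose P x := sup (S x).
have Pub x y : vle 0 y -> vle y x -> I y -> (f y : R) <= P x.
  move=> y0 yx Iy; apply: ub_le_sup; last by exists y.
  exists (M * `|x|) => _ [z [z0 zx _] <-].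
  apply: le_trans (ler_norm _) (le_trans (fM z) _).
  by apply: ler_wpM2l => //; exact: norm_vle.
have Ple x c : vle 0 x ->
    (forall y, vle 0 y -> vle y x -> I y -> (f y : R) <= c) -> P x <= c.
  move=> x0 fc; apply: ge_sup; last by move=> _ [z [z0 zx Iz] <-]; exact: fc.
  by exists (f 0), 0 => //; split=> //; exact: vle_refl.
have PZ a x : 0 < a -> vle 0 x -> P (a *: x) = a * P x.
  have le b y : 0 < b -> vle 0 y -> P (b *: y) <= b * P y.
    move=> b0 y0; apply: Ple => [|z z0 zb Iz].
      by apply: vscaler_ge0 => //; exact: ltW.
    have bV : 0 <= b^-1 by rewrite invr_ge0 ltW.
    rewrite -[z](scalerKV (lt0r_neq0 b0)) dualZ ler_pM2l//.
    apply: Pub; [exact: vscaler_ge0| |exact: IZ].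
    by rewrite -(scalerK (lt0r_neq0 b0) y); exact: vleZ.
  move=> a0 x0; apply/eqP; rewrite eq_le le//=.
  have ax0 : vle 0 (a *: x) by apply: vscaler_ge0 => //; exact: ltW.
  rewrite -{1}(scalerK (lt0r_neq0 a0) x) -ler_pdivlMl// le// invr_gt0//.
have PD x y : vle 0 x -> vle 0 y -> P (x + y) = P x + P y.
  move=> x0 y0; have xy0 := vaddr_ge0 x0 y0; apply/eqP; rewrite eq_le; apply/andP; split.
    apply: Ple => // z z0 zxy Iz.
    have [z1 [z2 [zE [z10 z1x] [z20 z2y]]]] := riesz_decomposition z0 zxy x0 y0.
    rewrite zE dualD; apply: lerD; apply: Pub => //.
      by apply: Idown (z10) _ Iz; rewrite zE; exact: vleDr.
    by apply: Idown (z20) _ Iz; rewrite zE; exact: vleDl.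
  rewrite -lerBrDr; apply: (Ple) => // z1 z10 z1x Iz1.
  rewrite lerBrDr -lerBrDl; apply: Ple => // z2 z20 z2y Iz2.
  rewrite lerBrDl -dualD; apply: Pub; [exact: vaddr_ge0|exact: vleD|exact: ID].
have PM x : vle 0 x -> `|P x| <= M * `|x|.
  move=> x0; rewrite ger0_norm; last first.
    by rewrite -(dual0 f); apply: Pub => //; exact: vle_refl.
  apply: Ple => // z z0 zx _; apply: le_trans (ler_norm _) (le_trans (fM z) _).
  by apply: ler_wpM2l => //; exact: norm_vle.
have [p pE] := dual_cone_ext PD PZ PM.
exists p => x x0; rewrite pE//; split=> [y|c]; [exact: Pub|exact: Ple].
Qed.

(* [|f| = 2 f^+ - f], where [f^+ x] is the supremum of [f] on [[0, x]]. *)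
Lemma dual_modulus_exists_le f : exists2 g, dual_modulus f g &
  forall x c, vle 0 x -> (forall y, vle 0 y -> vle y x -> (f y : R) <= c) ->
    (g x : R) <= 2 * c - (f x : R).
Proof.
have idT : positive_ideal setT by split.
have [p pP] := ideal_functional f idT.
have [M M0 fM] := dual_bound f; have [N N0 pN] := dual_bound p.
have [g gE] : exists g : dual E, forall x, g x = 2 * (p x : R) - (f x : R).
  apply: (@mk_dual _ _ _ (2 * N + M)) => [x y|a x|x].
  - by rewrite !dualD; ring.
  - by rewrite !dualZ; ring.
  rewrite [leRHS]mulrDl; apply: le_trans (ler_normB _ _) _; apply: lerD => //.
  by rewrite normrM normr_nat -mulrA ler_wpM2l.
exists g => [|x c x0 fc]; last first.
  have [_ pl] := pP x x0; have : (p x : R) <= c :> R by apply: pl => y *; exact: fc.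
  by rewrite gE; lra.
split=> [x x0|x x0|h fh fNh x x0]; have [pu pl] := pP x x0.
- by have := pu x x0 (vle_refl x) I; rewrite gE; lra.
- by have := pu 0 (vle_refl 0) x0 I; rewrite dual0 gE; lra.
rewrite gE; have : p x <= ((h x : R) + (f x : R)) / 2.
  apply: pl => y y0 yx _.
  have xy : vle 0 (x - y) by apply/vsub_ge0.
  by have := fh y y0; have := fNh _ xy; rewrite !dualB; lra.
lra.
Qed.

Lemma dual_modulus_exists f : exists g, dual_modulus f g.
Proof. by have [g fg _] := dual_modulus_exists_le f; exists g. Qed.

Section modulus.
Variables (f g : dual E) (fg : dual_modulus f g).

Lemma dual_modulus_ge0 x : vle 0 x -> 0 <= (g x : R).
Proof. by case: fg => fleg Nfleg _ x0; have := fleg x x0; have := Nfleg x x0; lra. Qed.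

Lemma dual_modulus_mono x y : vle x y -> (g x : R) <= g y.
Proof. by move=> /vsub_ge0/dual_modulus_ge0; rewrite dualB subr_ge0. Qed.

Lemma dual_modulus_abs x : `|f x : R| <= g (vabs x).
Proof.
case: fg => fleg Nfleg _; have x0 := vpos_ge0 x; have Nx0 := vpos_ge0 (- x).
rewrite -{1}(vposBN x) vabsE dualB dualD ler_norml.
have := fleg _ x0; have := fleg _ Nx0; have := Nfleg _ x0; have := Nfleg _ Nx0.
by lra.
Qed.

(** The modulus is below a functional [h] with [h x <= 2 * c - f x], and [- f x <= c]; hence the
    constant 3. *)
Lemma dual_modulus_le x (c : R) : vle 0 x ->
  (forall y, vle 0 y -> vle y x -> `|(f y : R)| <= c) -> (g x : R) <= 3 * c.
Proof.
move=> x0 fc; have [h [fh fNh _] hle] := dual_modulus_exists_le f.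
case: fg => _ _ /(_ h fh fNh x x0) /le_trans; apply.
have : (h x : R) <= 2 * c - (f x : R).
  apply: hle => // y y0 yx; exact: le_trans (ler_norm _) (fc _ y0 yx).
by have := fc x x0 (vle_refl x); rewrite ler_norml; lra.
Qed.

(** If every [y] failed, [dual_modulus_le] would give [g x <= 3 / 4 * g x], so [g x = 0] and [y = 0]
    would serve after all. The constant 4 is chosen to exceed 3. *)
Lemma dual_modulus_witness x : vle 0 x ->
  exists y, [/\ vle 0 y, vle y x & (g x : R) <= 4 * `|(f y : R)|].
Proof.
move=> x0; apply: contrapT => nex.
have : (g x : R) <= 3 * ((g x : R) / 4).
  apply: dual_modulus_le => // y y0 yx; rewrite leNgt; apply/negP => lt.
  by apply: nex; exists y; split=> //; move: lt; lra.
have [gx0|] := eqVneq (g x : R) 0; last by have := dual_modulus_ge0 x0; lra.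
case: nex; exists 0; split=> //; first exact: vle_refl.
by rewrite gx0 mulr_ge0.
Qed.

End modulus.
End ideals.

(** * Explicit bounds, summability and recursive choice *)

Lemma bounded_in (R : realType) (V : normedModType R) (T : Type) (f : T -> V)
    (A : set T) (M : R) :
  (forall x, A x -> `|f x| <= M) -> [bounded f x | x in A].
Proof.
move=> fM; exists M; split=> [|N MN x Ax] /=; first exact: num_real.
exact: le_trans (fM x Ax) (ltW MN).
Qed.

Lemma bounded_in_ex (R : realType) (V : normedModType R) (T : Type) (f : T -> V)
    (A : set T) :
  [bounded f x | x in A] -> exists2 M : R, 0 <= M & forall x, A x -> `|f x| <= M.
Proof.
move=> [M [_ fM]]; exists (`|M| + 1) => [|x]; first exact: addr_ge0.
by apply: fM; rewrite (le_lt_trans (ler_norm M))// ltrDl.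
Qed.

Section real_sequences.
Variable R : realType.
Implicit Types (u v a : nat -> R).

Lemma cvgr0_le u v : (forall n, `|u n| <= v n) ->
  v n @[n --> \oo] --> (0 : R) -> u n @[n --> \oo] --> (0 : R).
Proof.
move=> uv /cvgr0Pnorm_le v0; apply/cvgr0Pnorm_le => e e0.
by apply: filterS (v0 e e0) => n vn; exact: le_trans (uv n) (le_trans (ler_norm _) vn).
Qed.

Lemma cvgr0_near u e : u n @[n --> \oo] --> (0 : R) -> 0 < e ->
  \forall n \near \oo, `|u n| <= e.
Proof. by move=> /cvgr0Pnorm_le; exact. Qed.

(** Some finite list [s] attains the supremum of all finite sums up to [e]. A list beyond the
    largest index of [s] is disjoint from [s], so appending it adds at most [e]. *)
Lemma summable_tail a C : (forall i, 0 <= a i) ->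
  (forall s, uniq s -> \sum_(i <- s) a i <= C) ->
  forall e, 0 < e -> exists J, forall s, uniq s -> all (leq J) s ->
    \sum_(i <- s) a i <= e.
Proof.
move=> a0 aC e e0.
pose S := [set \sum_(i <- s) a i | s in [set s | uniq s]].
have hS : has_sup S.
  by split; [exists (\sum_(i <- [::]) a i), [::]|exists C => _ [s us <-]; exact: aC].
have [_ [s us <-] ltS] := sup_adherent e0 hS.
exists (\max_(i <- s) i).+1 => r ur /allP rJ.
rewrite -(lerD2l (\sum_(i <- s) a i)) -big_cat.
have : \sum_(i <- s ++ r) a i <= sup S.
  apply: ub_le_sup; first by case: hS.
  exists (s ++ r) => //=; rewrite cat_uniq us ur andbT /=.
  apply/hasPn => i /rJ; apply: contraL => si.
  by rewrite -leqNgt; exact: leq_bigmax_seq.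
by move=> /le_trans; apply; move: ltS; rewrite ltrBlDr => /ltW.
Qed.

Lemma summable_cvg0 a C : (forall i, 0 <= a i) ->
  (forall s, uniq s -> \sum_(i <- s) a i <= C) -> a n @[n --> \oo] --> (0 : R).
Proof.
move=> a0 aC; apply/cvgr0Pnorm_le => e e0.
have [J aJ] := summable_tail a0 aC e0; exists J => // n /= Jn.
by have := aJ [:: n] isT; rewrite big_seq1 /= Jn ger0_norm// => ->.
Qed.

End real_sequences.

(** Dependent choice in which each term may depend on the list [mkseq u n] of all its
    predecessors. *)
Lemma greedy_sequence (T : Type) (P : seq T -> T -> Prop) :
  (forall s, exists t, P s t) -> exists u : nat -> T, forall n, P (mkseq u n) (u n).
Proof.
move=> /choice[next nextP]; pose st n := iter n (fun s => rcons s (next s)) [::].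
exists (next \o st) => n; suff -> : mkseq (next \o st) n = st n by exact: nextP.
by elim: n => // n IH; rewrite mkseqS IH.
Qed.

(** * The gliding hump *)

Section gliding_hump.
Variables (R : realType) (X : normedModType R) (phi : nat -> dual X) (M : R).
Hypothesis phiM : forall x s, uniq s -> \sum_(i <- s) `|(phi i x : R)| <= M * `|x|.

Lemma summable_dual_tail x e : 0 < e ->
  exists J, forall s, uniq s -> all (leq J) s -> \sum_(i <- s) `|(phi i x : R)| <= e.
Proof. by apply: summable_tail => // s; exact: phiM. Qed.

(** The series converges absolutely at every point, and the bound on its partial sums passes to the
    limit. *)
Lemma summable_dual : exists F : dual X, forall x,
  (\sum_(0 <= i < n) (phi i x : R)) @[n --> \oo] --> (F x : R).
Proof.
pose S x n : R := \sum_(0 <= i < n) (phi i x : R).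
have absM x n : \sum_(0 <= i < n) `|(phi i x : R)| <= M * `|x|.
  by apply: phiM; exact: iota_uniq.
have /choice[F FS] : forall x, exists l : R, S x n @[n --> \oo] --> l.
  move=> x; apply/cvg_ex; apply: (@normed_cvg _ R^o (fun i => phi i x)).
  apply: nondecreasing_is_cvgn => [m n mn|].
    by apply: (@nondecreasing_series _ (fun i => `|(phi i x : R)|) xpredT) => // i _ _.
  by exists (M * `|x|) => _ [n _ <-]; exact: absM.
have uniq_lim u (l l' : R) : u n @[n --> \oo] --> l -> u n @[n --> \oo] --> l' -> l = l'.
  by apply: cvg_unique; exact: Rhausdorff.
have [g gF] : exists g : dual X, forall x, g x = F x :> R.
  apply: (@mk_dual _ _ _ M) => [x y|a x|x].
  - apply: (uniq_lim _ _ _ (FS _)).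
    suff -> : S (x + y) = (fun n => S x n + S y n) by exact: cvgD.
    by apply/funext => n; rewrite /S -big_split /=; apply: eq_bigr => i _; rewrite dualD.
  - apply: (uniq_lim _ _ _ (FS _)).
    suff -> : S (a *: x) = (fun n => a * S x n) by apply: cvgM => //; exact: cvg_cst.
    by apply/funext => n; rewrite /S /= mulr_sumr; apply: eq_bigr => i _; rewrite dualZ.
  - apply: (closed_cvg (fun z => z <= M * `|x|)) (cvg_norm (FS x)).
      exact: closed_le.
    by near=> n; apply: le_trans (ler_norm_sum _ _ _) _; exact: absM.
by exists g => x; rewrite gF; exact: FS.
Unshelve. all: by end_near. Qed.

End gliding_hump.

(** Otherwise indices [u n] are found with [phi (u n)] larger than [e] at its own point
    [x (k (u n))], while all other chosen functionals together contribute at most [e / 2] there. The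
    sum [F] of the chosen functionals is then at least [e / 2] at these points, although [x] is
    weakly null and [k (u n) >= n]. *)
Lemma gliding_hump (R : realType) (X : normedModType R) (phi : nat -> dual X)
    (M : R) (x : nat -> X) (k : nat -> nat) :
  (forall x s, uniq s -> \sum_(i <- s) `|(phi i x : R)| <= M * `|x|) ->
  weakly_null x -> phi j (x (k j)) @[j --> \oo] --> (0 : R).
Proof.
move=> phiM x0; apply/cvgr0Pnorm_le => e e0; apply: contrapT => nbad.
have e40 : 0 < e / 4 by rewrite divr_gt0.
(* Since [k] is arbitrary, [k j] must be forced to be large: by summability [phi j] is eventually at
   most [e] on the finitely many [x i] with [i < K]. *)
have bad J K : exists j, [/\ (J <= j)%N, (K <= k j)%N & e < `|(phi j (x (k j)) : R)|].
  have smallK : \forall j \near \oo, forall i : 'I_K, `|(phi j (x i) : R)| <= e.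
    apply: filter_forall => i; have [N NP] := summable_dual_tail phiM (x i) e0.
    by exists N => // j /= Nj; have := NP [:: j] isT; rewrite big_seq1 /= Nj => ->.
  apply: contrapT => nex; apply: nbad; near=> j.
  rewrite leNgt; apply/negP => ej; apply: nex; exists j; split=> //.
    by near: j; exists J.
  rewrite leqNgt; apply/negP => kjK; move: ej; apply/negP; rewrite -leNgt.
  by have /(_ (Ordinal kjK)) : forall i : 'I_K, `|(phi j (x i) : R)| <= e by near: j.
(* The new index [j] lies beyond the tails at the old points, the old functionals are small at the
   new point, [k j] grows, and [phi j] has its hump there. *)
pose P s j := [/\ forall l, l \in s -> (l < j)%N /\
      (forall r, uniq r -> all (leq j) r ->
         \sum_(i <- r) `|(phi i (x (k l)) : R)| <= e / 4),
  \sum_(i <- s) `|(phi i (x (k j)) : R)| <= e / 4,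
  (size s <= k j)%N & e < `|(phi j (x (k j)) : R)|].
have [u uP] : exists u : nat -> nat, forall n, P (mkseq u n) (u n).
  apply: greedy_sequence => s.
  have [J JP] : exists J, forall l, l \in s -> (l < J)%N /\
      (forall r, uniq r -> all (leq J) r ->
         \sum_(i <- r) `|(phi i (x (k l)) : R)| <= e / 4).
    elim: s => [|i s [J JP]]; first by exists 0%N.
    have [J' J'P] := summable_dual_tail phiM (x (k i)) e40.
    have tail_le J1 J2 (r : seq nat) : (J1 <= J2)%N -> all (leq J2) r -> all (leq J1) r.
      by move=> J12; apply: sub_all => j; exact: leq_trans.
    exists (maxn i.+1 (maxn J J')) => l; rewrite inE => /orP[/eqP->|/JP[lJ lP]].
      split; first exact: leq_maxl.
      move=> r ur /tail_le ar; apply: J'P => //; apply: ar.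
      by rewrite !leq_max leqnn !orbT.
    split; first by rewrite !leq_max lJ orbT.
    move=> r ur /tail_le ar; apply: lP => //; apply: ar.
    by rewrite !leq_max leqnn !orbT.
  have [K _ KP] : \forall n \near \oo, \sum_(i <- s) `|(phi i (x n) : R)| <= e / 4.
    have : \sum_(i <- s) `|(phi i (x n) : R)| @[n --> \oo] --> (0 : R).
      elim: s {JP} => [|i s IH].
        by under eq_fun do rewrite big_nil; exact: cvg_cst.
      under eq_fun do rewrite big_cons.
      by have := cvgD (cvg_norm (x0 (phi i))) IH; rewrite normr0 addr0; exact.
    move=> /cvgr0_near /(_ e40); apply: filterS => n.
    by rewrite ger0_norm// sumr_ge0.
  have [j [Jj Kj ej]] := bad J (maxn K (size s)).
  move: Kj; rewrite geq_max => /andP[Kj sj].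
  exists j; split=> // [l /JP[lJ lP]|]; last exact: KP.
  split; first exact: leq_trans Jj.
  by move=> r ur ar; apply: lP => //; apply: sub_all ar => i; exact: leq_trans.
have ult l m : (l < m)%N -> (u l < u m)%N.
  by move=> lm; have [/(_ (u l))[]] := uP m; rewrite // map_f// mem_iota.
have uinj : injective u.
  move=> l m ulm; apply/eqP; rewrite eqn_leq; apply/andP; split;
    by rewrite leqNgt; apply/negP => /ult; rewrite ulm ltnn.
have [F FP] : exists F : dual X, forall y,
    (\sum_(0 <= l < n) (phi (u l) y : R)) @[n --> \oo] --> (F y : R).
  apply: (@summable_dual _ _ (phi \o u) M) => y s us.
  by have := @phiM y (map u s); rewrite big_map map_inj_uniq//; exact.
have [K _ FK] := cvgr0_near (x0 F) e40.
have [Psmall Pum Pk Pe] := uP K.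
rewrite size_mkseq in Pk.
have : e / 2 <= `|(F (x (k (u K))) : R)|.
  set y := x _; apply: (closed_cvg (fun z => e / 2 <= z)) (cvg_norm (FP y)).
    exact: closed_ge.
  exists K.+1 => // n /= Kn.
  rewrite (@big_cat_nat _ _ _ K)//=; last exact: ltnW.
  rewrite [X in _ + X]big_ltn//.
  have h1 : `|\sum_(0 <= l < K) (phi (u l) y : R)| <= e / 4.
    apply: le_trans (ler_norm_sum _ _ _) _; move: Pum.
    by rewrite big_map /index_iota subn0.
  have h2 : `|\sum_(K.+1 <= l < n) (phi (u l) y : R)| <= e / 4.
    apply: le_trans (ler_norm_sum _ _ _) _.
    (* The later functionals are controlled by the choice made at stage [K.+1], where [u K] is
       already among the predecessors. *)
    have [/(_ (u K))[|_]] := uP K.+1; first by rewrite map_f// mem_iota /=.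
    move=> /(_ (map u (index_iota K.+1 n))); rewrite big_map => h _ _ _; apply: h.
      by rewrite map_inj_uniq// iota_uniq.
    apply/allP => _ /mapP[l + ->]; rewrite mem_index_iota => /andP[Kl _].
    by move: Kl; rewrite leq_eqVlt => /orP[/eqP->//|/ult/ltnW].
  set A := \sum_(0 <= l < K) _ in h1 *; set B := \sum_(K.+1 <= l < n) _ in h2 *.
  set c : R := phi _ _ in Pe *.
  have : `|c| <= `|A + (c + B)| + `|A| + `|B|.
    rewrite -{1}(addrK B c) -{1}(addrK A (c + B)).
    rewrite [c + B + A]addrC; apply: le_trans (ler_normB _ _) _; rewrite lerD2r.
    exact: ler_normB.
  move: Pe h1 h2; move: (`|A + (c + B)|) (`|A|) (`|B|) (`|c|) => r1 r2 r3 r4.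
  by lra.
have := FK _ Pk; lra.
Unshelve. all: by end_near. Qed.

Lemma sum_uniq_le (R : realDomainType) (a : nat -> R) (C : R) : (forall i, 0 <= a i) ->
  (forall n, \sum_(0 <= i < n) a i <= C) ->
  forall s, uniq s -> \sum_(i <- s) a i <= C.
Proof.
move=> a0 aC s us; pose n := (\max_(i <- s) i).+1; apply: le_trans (aC n).
have /(perm_big _) -> : perm_eq s [seq i <- index_iota 0 n | i \in s].
  apply: uniq_perm => //; first by rewrite filter_uniq// iota_uniq.
  move=> i; rewrite mem_filter mem_index_iota /=; case: (boolP (i \in s)) => //= si.
  by rewrite ltnS leq_bigmax_seq.
by rewrite big_filter big_mkcond /=; apply: ler_sum => i _; case: ifP.
Qed.

Lemma geometric_half_le (R : realFieldType) n :
  \sum_(0 <= i < n) (2^-1 ^+ i : R) <= 2.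
Proof.
suff -> : \sum_(0 <= i < n) (2^-1 ^+ i : R) = 2 - 2 * 2^-1 ^+ n.
  by rewrite gerBl mulr_ge0// exprn_ge0.
elim: n => [|n IH]; first by rewrite big_geq// expr0; ring.
by rewrite big_nat_recr//= IH exprS; field.
Qed.

(** * Norming functionals and boundedness of weakly null sequences *)

Section hahn_banach.
Variables (R : realType) (X : normedModType R).
Implicit Types (p q : X -> R) (x y z : X).

(** Homogeneity is an inequality; its instance at [t^-1] gives the reverse one. *)
Definition sublinear p :=
  (forall x y, p (x + y) <= p x + p y) /\ (forall t x, 0 < t -> p (t *: x) <= t * p x).

Lemma sublinear_normr : sublinear (fun x => `|x|).
Proof.
by split=> [|t x t0]; [exact: ler_normD|rewrite normrZ gtr0_norm].
Qed.

Lemma sublinear_ge p x : sublinear p -> - p (- x) <= p x.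
Proof.
move=> [pD pZ]; have := pD x (- x); rewrite subrr.
by have := pD 0 0; rewrite addr0; lra.
Qed.

(** Serves both for the shift of a functional, with [I] the scalars, and for the lower bound of a
    chain in Zorn's lemma. *)
Lemma sublinear_inf (I : Type) (S : set I) (G : I -> X -> R) : S !=set0 ->
  (forall x, has_lbound [set G i x | i in S]) ->
  (forall i j x y, S i -> S j -> exists2 k, S k & G k (x + y) <= G i x + G j y) ->
  (forall i t x, S i -> 0 < t -> exists2 k, S k & G k (t *: x) <= t * G i x) ->
  sublinear (fun x => inf [set G i x | i in S]).
Proof.
move=> [i0 Si0] Glb GD GZ.
have infle i x : S i -> inf [set G i x | i in S] <= G i x.
  by move=> Si; apply: ge_inf => //; exists i.
have leinf x c : (forall i, S i -> c <= G i x) -> c <= inf [set G i x | i in S].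
  by move=> cG; apply: lb_le_inf; [exists (G i0 x), i0|move=> _ [i Si <-]; exact: cG].
split=> [x y|t x t0].
  rewrite -lerBlDl; apply: (leinf) => j Sj; rewrite lerBlDl -lerBlDr.
  apply: leinf => i Si; rewrite lerBlDr.
  have [k Sk] := GD i j x y Si Sj; apply: le_trans; exact: infle.
rewrite mulrC -ler_pdivrMr//; apply: leinf => i Si; rewrite ler_pdivrMr// mulrC.
have [k Sk] := GZ i t x Si t0; apply: le_trans; exact: infle.
Qed.

(** The functional is lowered in the direction [- z]: the index [t = 0] keeps it below [p], and
    [t = 1] bounds it by [p (y + z) - p z]. *)
Definition sublinear_shift p z y :=
  inf [set p (y + t *: z) - t * p z | t in [set t | 0 <= t]].

Lemma sublinear_shiftP p z : sublinear p ->
  sublinear (sublinear_shift p z) /\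
  forall t y, 0 <= t -> sublinear_shift p z y <= p (y + t *: z) - t * p z.
Proof.
move=> sp; have [pD pZ] := sp.
have lb y : has_lbound [set p (y + t *: z) - t * p z | t in [set t | 0 <= t]].
  exists (- p (- y)) => _ [t t0 <-].
  have := pD (- y) (y + t *: z); rewrite addKr.
  suff : t * p z <= p (t *: z) by lra.
  move: t0; rewrite /= le_eqVlt => /predU1P[<-|t0].
    by rewrite mul0r scale0r; have := pD 0 0; rewrite addr0; lra.
  rewrite mulrC -ler_pdivlMr// mulrC -{1}(scalerK (lt0r_neq0 t0) z).
  by apply: pZ; rewrite invr_gt0.
split; last by move=> t y t0; apply: ge_inf => //; exists t.
apply: sublinear_inf => //; first by exists 0 => /=.
  move=> t r x y /= t0 r0; exists (t + r); first exact: addr_ge0.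
  have := pD (x + t *: z) (y + r *: z); rewrite addrACA -scalerDl; lra.
move=> r t x /= r0 t0; exists (t * r); first by rewrite mulr_ge0// ltW.
by have := pZ t (x + r *: z) t0; rewrite scalerDr scalerA; nra.
Qed.

(* A minimal sublinear functional is linear, because [sublinear_shift p z <= p]
   forces [p y + p z <= p (y + z)]. *)
Lemma hahn_banach_norm x :
  exists f : dual X, (forall y, `|(f y : R)| <= `|y|) /\ f x = `|x| :> R.
Proof.
(* Zorn's lemma starts from the norm shifted along [x], so that everything below it is at most the
   negative of the norm of [x] at [- x]; this forces equality at [x]. *)
have [sp0 p0le] := sublinear_shiftP x sublinear_normr.
set p0 := sublinear_shift _ x in sp0 p0le.
pose T := {p | sublinear p /\ forall y, p y <= p0 y}.
(* The order is reversed, so that a premaximal element is a pointwise minimal functional and a chain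
   is bounded by its pointwise infimum. *)
pose leT (p q : T) := `[< forall y, sval q y <= sval p y >].
have p0norm y : p0 y <= `|y|.
  by have := p0le 0 y (lexx 0); rewrite scale0r addr0 mul0r subr0.
have [[p [sp pp0]] pmin] : exists t : T, premaximal leT t.
  apply: (ZL_preorder (exist _ p0 (conj sp0 (fun y => lexx _)))) => [v|u v w|A totA].
  - by apply/asboolP.
  - by move=> /asboolP uv /asboolP vw; apply/asboolP => y; exact: le_trans (vw y) (uv y).
  have [[q0 Aq0]|A0] := pselect (A !=set0); last first.
    exists (exist _ p0 (conj sp0 (fun y => lexx _))) => s As.
    by case: A0; exists s.
  have Alb y : has_lbound [set sval q y | q in A].
    exists (- `|y|) => _ [q Aq <-]; have [sq qp0] := svalP q.
    apply: le_trans (sublinear_ge y sq); rewrite lerN2 -normrN.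
    exact: le_trans (qp0 _) (p0norm _).
  have sr : sublinear (fun y => inf [set sval q y | q in A]).
    apply: sublinear_inf => //; first by exists q0.
      move=> p q y z Ap Aq; have [/asboolP|/asboolP] := totA p q Ap Aq => pq.
        exists q => //; have [[qD _] _] := svalP q.
        by apply: le_trans (qD y z) _; rewrite lerD2r.
      exists p => //; have [[pD _] _] := svalP p.
      by apply: le_trans (pD y z) _; rewrite lerD2l.
    by move=> p t y Ap t0; exists p => //; have [[_ pZ] _] := svalP p; exact: pZ.
  have rle (v : T) y : A v -> inf [set sval q y | q in A] <= sval v y.
    by move=> Av; apply: ge_inf => //; exists v.
  unshelve eexists (exist _ (fun y => inf [set sval q y | q in A]) _).
    split=> // y; apply: le_trans (rle _ _ Aq0) _; exact: (svalP q0).2.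
  by move=> s As; apply/asboolP => y; exact: rle.
have pD y z : p (y + z) = p y + p z.
  have [ss sle] := sublinear_shiftP z sp.
  have slep w : sublinear_shift p z w <= p w.
    by have := sle 0 w (lexx 0); rewrite scale0r addr0 mul0r subr0.
  have sp0' : sublinear (sublinear_shift p z) /\ forall y, sublinear_shift p z y <= p0 y.
    by split=> // w; exact: le_trans (slep w) (pp0 w).
  have /pmin/asboolP/(_ y) /= ples : leT (exist _ p (conj sp pp0)) (exist _ _ sp0').
    by apply/asboolP => w; exact: slep.
  have := le_trans ples (sle 1 y ler01); rewrite scale1r mul1r => pyz.
  by apply/eqP; rewrite eq_le sp.1 /=; move: pyz; lra.
have pN y : p (- y) = - p y.
  have := pD 0 0; have := pD y (- y); rewrite subrr addr0; lra.
have pZp t y : 0 < t -> p (t *: y) = t * p y.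
  move=> t0; apply/eqP; rewrite eq_le sp.2//= mulrC -ler_pdivlMr// mulrC.
  by rewrite -{1}(scalerK (lt0r_neq0 t0) y) sp.2// invr_gt0.
have pZ t y : p (t *: y) = t * p y.
  have [t0|t0|->] := ltgtP t 0; last 2 first.
  - exact: pZp.
  - by rewrite scale0r mul0r; have := pD 0 0; rewrite addr0; lra.
  by rewrite -[t]opprK scaleNr pN pZp ?oppr_gt0// !mulNr.
have pnorm y : p y <= `|y| := le_trans (pp0 y) (p0norm y).
have pabs y : `|p y| <= 1 * `|y|.
  by rewrite mul1r ler_norml pnorm andbT lerNl -pN -(normrN y).
have [f fE] := mk_dual pD pZ pabs.
exists f; split=> [y|]; first by rewrite fE -[leRHS]mul1r.
rewrite fE; apply/eqP; rewrite eq_le pnorm /=.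
have := le_trans (pp0 (- x)) (p0le 1 (- x) ler01).
by rewrite scale1r addNr normr0 mul1r pN sub0r lerN2.
Qed.

(** If unbounded, pick [x (k j)] of norm at least [2 ^+ j] and a norming functional scaled by
    [2^-1 ^+ j]. These functionals are summable with bound 2, yet take values at least 1 at
    [x (k j)], against the gliding hump. *)
Lemma weakly_null_bounded (x : nat -> X) : weakly_null x -> bounded_set (range x).
Proof.
move=> x0; apply: contrapT => unb.
have /choice[k kP] : forall j : nat, exists k, 2 ^+ j <= `|x k|.
  move=> j; apply: contrapT => nk; apply: unb.
  apply: (@bounded_in _ _ _ _ _ (2 ^+ j)) => _ [k _ <-]; rewrite leNgt; apply/negP => lt.
  by apply: nk; exists k; exact: ltW.
have /choice[psi psiP] := fun j => hahn_banach_norm (x (k j)).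
have /choice[phi phiE] : forall j, exists f : dual X,
    forall y, f y = 2^-1 ^+ j * psi j y :> R.
  move=> j; apply: (@mk_dual _ _ _ (2^-1 ^+ j)) => [y z|a y|y].
  - by rewrite dualD mulrDr.
  - by rewrite dualZ mulrCA.
  - by rewrite normrM ger0_norm ?exprn_ge0// ler_wpM2l ?exprn_ge0//; case: (psiP j).
suff /cvgr0Pnorm_le/(_ 2^-1) : phi j (x (k j)) @[j --> \oo] --> (0 : R).
  case=> [|N _ /(_ N (leqnn N)) /=]; first by rewrite invr_gt0.
  rewrite phiE (psiP N).2 normrM normr_id ger0_norm ?exprn_ge0// exprVn.
  rewrite ler_pdivrMl ?exprn_gt0//.
  by have := kP N; have := exprn_gt0 N (@ltr0Sn R 1); lra.
apply: (@gliding_hump _ _ phi 2 x k) => // y s.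
apply: (sum_uniq_le (a := fun i => `|(phi i y : R)|)) => // n.
apply: le_trans (ler_wpM2r (normr_ge0 y) (geometric_half_le R n)); rewrite mulr_suml.
apply: ler_sum => i _; rewrite phiE normrM ger0_norm ?exprn_ge0//.
by rewrite ler_wpM2l ?exprn_ge0//; case: (psiP i).
Qed.

End hahn_banach.

(** * Disjoint sequences and weak convergence *)

Section disjoint_sequences.
Variables (R : realType) (E : banachLatticeType R).
Implicit Types (f g h : dual E) (x y z : E) (w a : nat -> E).

Definition dual_ge0 h := forall x, vle 0 x -> 0 <= (h x : R).

Lemma dual_ge0_mono h x y : dual_ge0 h -> vle x y -> (h x : R) <= h y.
Proof. by move=> h0 /vsub_ge0/h0; rewrite dualB subr_ge0. Qed.

Lemma dual_ge0_abs h x : dual_ge0 h -> `|(h x : R)| <= h (vabs x).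
Proof.
move=> h0; rewrite ler_norml; apply/andP; split; last first.
  exact: (dual_ge0_mono h0 (vle_abs x)).
by rewrite lerNl -dualN; exact: (dual_ge0_mono h0 (vleN_abs x)).
Qed.

(* The [p j] are the restrictions of [h] to the disjoint bands generated by the [a j]. *)
Lemma disjoint_components h a : dual_ge0 h -> (forall j, vle 0 (a j)) ->
  (forall i j, i != j -> vmeet (a i) (a j) = 0) ->
  exists p : nat -> dual E,
  [/\ forall j, dual_ge0 (p j),
      forall j x, vle 0 x -> vle (a j) x -> (h (a j) : R) <= p j x,
      forall j x, vle 0 x -> vmeet (a j) x = 0 -> (p j x : R) <= 0
    & forall x s, vle 0 x -> uniq s -> \sum_(j <- s) (p j x : R) <= h x].
Proof.
move=> h0 a0 ad; pose I j := [set y | exists2 t, 0 <= t & vle y (t *: a j)].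
have II j : positive_ideal (I j).
  split=> [|x y [t t0 xt] [r r0 yr]|t x t0 [r r0 xr]|x y _ xy [t t0 yt]].
  - by exists 0; rewrite // scale0r; exact: vle_refl.
  - by exists (t + r); [exact: addr_ge0|rewrite scalerDl; exact: vleD].
  - by exists (t * r); [exact: mulr_ge0|rewrite -scalerA; exact: vleZ].
  - by exists t => //; exact: vle_trans yt.
have aI j : I j (a j) by exists 1; rewrite // scale1r; exact: vle_refl.
have /choice[p pP] := fun j => ideal_functional h (II j).
exists p; split=> [j x x0|j x x0 ax|j x x0 ax|x s x0 us].
- have [pu _] := pP j x x0; rewrite -(dual0 h); apply: pu (vle_refl 0) x0 _.
  by case: (II j).
- by have [pu _] := pP j x x0; apply: pu.
- have [_ pl] := pP j x x0; apply: pl => y y0 yx [t t0 yt].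
  suff -> : y = 0 by rewrite dual0.
  apply: vle_anti => //; rewrite -(vmeet_eq0Z t0 (a0 j) x0 ax).
  exact/vle_meet.
(* Each [p j x] is a supremum, so it is enough to bound the sums of [h (y j)] over all choices of
   [y j] in [I j] below [x]. Such [y j] are disjoint, hence add up to at most [x]. The induction on
   [s] then releases one supremum at a time. *)
suff : forall c : R,
    (forall y : nat -> E, (forall j, [/\ vle 0 (y j), vle (y j) x & I j (y j)]) ->
      \sum_(j <- s) (h (y j) : R) <= c) -> \sum_(j <- s) (p j x : R) <= c.
  apply=> y yP; rewrite -dual_sum; apply: dual_ge0_mono => //.
  apply: vsum_disjoint_le => // [j _|i j _ _ ij]; first by case: (yP j).
  have [yi0 _ [t t0 yit]] := yP i; have [yj0 _ [r r0 yjr]] := yP j.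
  apply: vmeet_eq0_le yi0 yj0 yit yjr _.
  have rj0 := vscaler_ge0 r0 (a0 j).
  apply: vmeet_eq0Z => //; rewrite vmeetC; apply: vmeet_eq0Z => //.
  by apply: ad; rewrite eq_sym.
elim: s us => [_ c|i s IH /= /andP[is_ us] c] yc.
  rewrite big_nil; have := yc (fun=> 0); rewrite big_nil; apply => j.
  by split; [exact: vle_refl|exact: x0|case: (II j)].
rewrite big_cons -lerBrDr; have [_ pl] := pP i x x0; apply: pl => z z0 zx Iz.
rewrite lerBrDr -lerBrDl; apply: IH => // y yP; rewrite lerBrDl.
have := yc (fun j => if j == i then z else y j); rewrite big_cons eqxx.
rewrite (eq_big_seq (fun j => h (y j) : R)); last first.
  by move=> j js /=; case: eqP => // ji; rewrite -ji js in is_.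
by apply=> j; case: eqP => [->|].
Qed.

Lemma disjoint_sum_abs h w x s : dual_ge0 h -> disjoint_seq w -> vle 0 x ->
  (forall n, vle (vabs (w n)) x) -> uniq s -> \sum_(n <- s) (h (vabs (w n)) : R) <= h x.
Proof.
move=> h0 wd x0 wx us; rewrite -dual_sum; apply: dual_ge0_mono => //.
apply: vsum_disjoint_le => // [n _|m n _ _]; first by split=> //; exact: vabs_ge0.
exact: wd.
Qed.

(** Finite sums of the disjoint [vabs (w n)] stay below [x], so the modulus of [f] is summable along
    them. *)
Lemma weakly_null_interval w x :
  disjoint_seq w -> (forall n, vle (vabs (w n)) x) -> weakly_null w.
Proof.
move=> wd wx f; have [g fg] := dual_modulus_exists f.
have g0 : dual_ge0 g by move=> y; exact: (dual_modulus_ge0 fg).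
have x0 : vle 0 x by apply: vle_trans (wx 0%N); exact: vabs_ge0.
apply: (@cvgr0_le _ _ (fun n => g (vabs (w n)))) => [n|]; first exact: dual_modulus_abs.
apply: (@summable_cvg0 _ _ (g x)) => [n|s]; first by apply: g0; exact: vabs_ge0.
exact: disjoint_sum_abs.
Qed.

(** With [a j] the meet in question and [p j] the component of [h] on it, [h (a j)] is at most [p j]
    of the positive part of [x (k j)]. The negative part is disjoint from [a j] and contributes
    nothing, so [p j (x (k j))] dominates, and the gliding hump applies to the [p j]. *)
Lemma disjoint_below_pos h w (x : nat -> E) (k : nat -> nat) : dual_ge0 h ->
  disjoint_seq w -> weakly_null x ->
  h (vmeet (vabs (w j)) (vpos (x (k j)))) @[j --> \oo] --> (0 : R).
Proof.
move=> h0 wd xn; pose a j := vmeet (vabs (w j)) (vpos (x (k j))).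
have a0 j : vle 0 (a j) by apply: vmeet_ge0; [exact: vabs_ge0|exact: vpos_ge0].
have ad i j : i != j -> vmeet (a i) (a j) = 0.
  by move=> /wd; apply: vmeet_eq0_le => //; apply: vle_meetl.
have [p [p0 pa pN ps]] := disjoint_components h0 a0 ad.
have [M M0 hM] := dual_bound h.
have := @gliding_hump _ _ p M x k; move=> /(_ _ xn); move=> gh.
apply: cvgr0_le (gh _) => [j|y s us]; last first.
  apply: (@le_trans _ _ (\sum_(j <- s) (p j (vabs y) : R))).
    by apply: ler_sum => j _; exact: dual_ge0_abs.
  apply: le_trans (ps _ _ (vabs_ge0 y) us) _.
  by apply: le_trans (ler_norm _) _; rewrite -(norm_vabs y).
rewrite ger0_norm; last exact: (h0 _ (a0 j)).
apply: le_trans (pa j _ (vpos_ge0 _) (vle_meetr _ _)) _.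
rewrite -{2}[x (k j)]vposBN dualB lerBrDr gerDl; apply: pN; first exact: vpos_ge0.
apply: vmeet_eq0_le (vpos_meetN (x (k j))) => //; first exact: vpos_ge0.
  exact: vle_meetr.
exact: vle_refl.
Qed.

(** By Riesz decomposition [vabs (w j)] is at most the sum of its meets with the positive and
    negative parts of [x (k j)]; [disjoint_below_pos] handles them through [x] and [- x]. *)
Lemma weakly_null_solid w (x : nat -> E) : disjoint_seq w -> weakly_null x ->
  (forall j, exists k, vle (vabs (w j)) (vabs (x k))) -> weakly_null w.
Proof.
move=> wd xn /choice[k wk] f; have [g fg] := dual_modulus_exists f.
have g0 : dual_ge0 g by move=> y; exact: (dual_modulus_ge0 fg).
have Nxn : weakly_null (fun n => - x n).
  move=> h; under eq_fun do rewrite dualN.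
  by have := cvgN (xn h); rewrite oppr0; apply.
pose v j : R := (g (vmeet (vabs (w j)) (vpos (x (k j)))) : R) +
                (g (vmeet (vabs (w j)) (vpos (- x (k j)))) : R).
have v0 : v j @[j --> \oo] --> (0 : R).
  have := cvgD (disjoint_below_pos k g0 wd xn) (disjoint_below_pos k g0 wd Nxn).
  by rewrite addr0; exact.
apply: (cvgr0_le _ v0) => j.
apply: le_trans (dual_modulus_abs fg _) _.
rewrite /v -dualD; apply: dual_ge0_mono => //.
have w0 := vabs_ge0 (w j); have := wk j; rewrite (vabsE (x (k j))) => wle.
have [y1 [y2 [yE [y10 y1x] [y20 y2x]]]] :=
  riesz_decomposition w0 wle (vpos_ge0 _) (vpos_ge0 _).
rewrite {1}yE; apply: vleD; apply/vle_meet; split=> //; rewrite yE.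
  exact: vleDr.
exact: vleDl.
Qed.

Lemma interval_disjointly_weakly_compact x :
  vle 0 x -> disjointly_weakly_compact [set y | vle 0 y /\ vle y x].
Proof.
move=> x0; split.
  by apply: (@bounded_in _ _ _ _ _ `|x|) => y [y0 yx]; exact: norm_vle.
move=> w wS wd; apply: (@weakly_null_interval w x wd) => n.
by have [y [y0 yx] wy] := wS n; apply: vle_trans yx; rewrite -(vabs_id y0).
Qed.

End disjoint_sequences.

(** * Vanishing suprema as uniform estimates *)

Section uniform_suprema.
Variables (R : realType) (T : Type) (F : nat -> T -> R) (A : set T).

Lemma sup_cvg0 :
  (forall e, 0 < e -> \forall n \near \oo, forall x, A x -> `|F n x| <= e) ->
  sup [set `|F n x| | x in A] @[n --> \oo] --> (0 : R).
Proof.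
move=> FA; apply/cvgr0Pnorm_le => e e0; apply: filterS (FA e e0) => n Fn.
have [[x Ax]|A0] := pselect (A !=set0); last first.
  suff -> : A = set0 by rewrite image_set0 sup0 normr0 ltW.
  by apply/eqP/negPn/negP => /set0P.
have ub : ubound [set `|F n x| | x in A] e by move=> _ [y Ay <-]; exact: Fn.
rewrite ger0_norm; first by apply: ge_sup => //; exists `|F n x|, x.
by apply: le_trans (normr_ge0 (F n x)) _; apply: ub_le_sup; [exists e|exists x].
Qed.

(** The bound for each [n] keeps [sup] from taking its default value on an unbounded set. *)
Lemma cvg0_sup : (forall n, exists M, forall x, A x -> `|F n x| <= M) ->
  sup [set `|F n x| | x in A] @[n --> \oo] --> (0 : R) ->
  forall e, 0 < e -> \forall n \near \oo, forall x, A x -> `|F n x| <= e.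
Proof.
move=> FM /cvgr0Pnorm_le F0 e e0; apply: filterS (F0 e e0) => n Fn x Ax.
apply: le_trans (le_trans (ler_norm _) Fn); apply: ub_le_sup; last by exists x.
by have [M MP] := FM n; exists M => _ [y Ay <-]; exact: MP.
Qed.

End uniform_suprema.

(** * Limited sets and the Gelfand-Phillips property of [c0] *)

Section limited_sets.
Variables (R : realType).

Lemma limited_uniform (X : normedModType R) (A : set X) (f : nat -> dual X) e :
  limited A -> weak_star_null f -> 0 < e ->
  \forall n \near \oo, forall x, A x -> `|(f n x : R)| <= e.
Proof.
move=> [bA lA] f0; apply: (@cvg0_sup _ _ (fun n x => f n x) A _ (lA f f0)) => n.
have [M M0 fM] := dual_bound (f n); have [N _ AN] := bounded_in_ex bA.
exists (M * N) => x Ax; apply: le_trans (fM x) _.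
by apply: ler_wpM2l => //; exact: AN.
Qed.

Lemma uniform_limited (X : normedModType R) (A : set X) : bounded_set A ->
  (forall (f : nat -> dual X) e, weak_star_null f -> 0 < e ->
    \forall n \near \oo, forall x, A x -> `|(f n x : R)| <= e) -> limited A.
Proof.
move=> bA fA; split=> // f f0.
by apply: (@sup_cvg0 _ _ (fun n x => f n x)) => e; exact: fA.
Qed.

Lemma limited_image (X Y : normedModType R) (T : bounded_linear X Y) (A : set X) :
  limited A -> limited (T @` A).
Proof.
move=> lA; have [M TM] := bounded_linearP T; apply: uniform_limited.
  have [N N0 AN] := bounded_in_ex lA.1.
  apply: (@bounded_in _ _ _ _ _ (`|M| * N)) => _ [x Ax <-].
  apply: le_trans (TM x) _; apply: le_trans (ler_wpM2r (normr_ge0 _) (ler_norm M)) _.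
  by apply: ler_wpM2l => //; exact: AN.
move=> g e g0 e0.
have /choice[f fE] : forall n, exists f : dual X, forall x, f x = g n (T x) :> R.
  move=> n; have [N N0 gN] := dual_bound (g n).
  apply: (@mk_dual _ _ _ (N * M)) => [x y|a x|x].
  - by rewrite raddfD dualD.
  - by rewrite linearZZ dualZ.
  - by apply: le_trans (gN _) _; rewrite -mulrA ler_wpM2l.
have f0 : weak_star_null f.
  by move=> x; under eq_fun do rewrite fE; exact: g0.
apply: filterS (limited_uniform lA f0 e0) => n fn _ [x Ax <-].
by rewrite -fE; exact: fn.
Qed.

Lemma weak_star_null_bounded (X : completeNormedModType R) (f : nat -> dual X) :
  weak_star_null f -> exists2 M : R, 0 <= M & forall n x, `|(f n x : R)| <= M * `|x|.
Proof.
move=> f0; have bl n : bounded_fun_norm (f n : X -> R^o) /\ linear (f n : X -> R^o).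
  split; last by move=> a x y; rewrite dualD dualZ.
  have [M M0 fM] := dual_bound (f n) => r; exists (M * r) => x xr.
  by apply: le_trans (fM x) _; exact: ler_wpM2l.
have [||M MP] := @Banach_Steinhauss R X R^o (range (fun n => f n : X -> R^o)) _ _ 1.
- by move=> _ [n _ <-].
- move=> x; have /cvg_seq_bounded/bounded_in_ex[M _ fM] : cvgn (fun n => f n x : R^o).
    by apply/cvg_ex; exists 0; exact: f0.
  by exists M => _ [n _ <-]; exact: fM.
have M0 : 0 <= M.
  have := MP (f 0%N) (ex_intro2 _ _ 0%N I erefl) 0; rewrite normr0 ler01 => /(_ isT).
  exact: le_trans.
exists M => // n x; have [->|x0] := eqVneq x 0; first by rewrite dual0 !normr0 mulr0.
have nx0 : 0 < `|x| by rewrite normr_gt0.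
have := MP (f n) (ex_intro2 _ _ n I erefl) (`|x|^-1 *: x).
rewrite normrZ normfV normr_id mulVf ?gt_eqF// lexx => /(_ isT).
by rewrite dualZ normrM normfV normr_id ler_pdivrMl// mulrC.
Qed.

(** By Banach-Steinhaus the functionals are uniformly Lipschitz, so smallness on a finite net gives
    smallness on the compact set. *)
Lemma precompact_limited (X : completeNormedModType R) (A : set X) :
  precompact A -> limited A.
Proof.
move=> [K AK [cK _]]; apply: uniform_limited => [|f e f0 e0].
  have [M _ KM] := bounded_in_ex (compact_bounded cK).
  by apply: (@bounded_in _ _ _ _ _ M) => x /AK/KM.
have [M M0 fM] := weak_star_null_bounded f0.
(* The mesh makes [M * d <= e / 2], and [M + 1] avoids dividing by zero. *)
pose d := e / 2 / (M + 1); have M1 : 0 < M + 1 by rewrite ltr_wpDl.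
have d0 : 0 < d by rewrite !divr_gt0.
move: cK; rewrite compact_cover => /(_ _ K (fun x => ball x d)).
case=> [x _|x Kx|D _ KD]; first exact: ball_open.
  by exists x => //; exact: ballxx.
have : \forall n \near \oo, forall y, y \in finmap.enum_fset D -> `|(f n y : R)| <= e / 2.
  elim: (finmap.enum_fset D) => [|y s IH]; first by near=> n.
  have e20 : 0 < e / 2 by rewrite divr_gt0.
  near=> n => z; rewrite inE => /predU1P[->|zs].
    by near: n; exact: cvgr0_near.
  by move: z zs; near: n.
apply: filterS => n fn x /AK/KD[y /= Dy]; rewrite -ball_normE /= => yx.
rewrite -(subrK y x) dualD; apply: le_trans (ler_normD _ _) _.
rewrite (splitr e); apply: lerD; last exact: fn.
apply: le_trans (fM _ _) _; rewrite distrC.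
apply: (@le_trans _ _ ((M + 1) * d)); last by rewrite /d mulrC divfK// gt_eqF.
by apply: ler_pM => //; [rewrite lerDl|exact: ltW].
Unshelve. all: by end_near. Qed.

Lemma c0_coordinate (n : nat) : exists f : dual (c0 R), forall u : c0 R, f u = u n :> R.
Proof.
by apply: (@mk_dual _ (c0 R) (fun u => u n) 1) => // u; rewrite mul1r; exact: c0_norm_ub.
Qed.

(* Bounded coordinates converge along an ultrafilter, and the common envelope [r]
   makes this convergence uniform. *)
Lemma c0_dominated_compact (r : nat -> R) : r n @[n --> \oo] --> (0 : R) ->
  compact [set u : c0 R | forall n, `|u n| <= r n].
Proof.
move=> r0; set K := [set u | _]; rewrite compact_ultra => F UF FK.
have near_l n : exists l : R, forall e, 0 < e -> F [set u : c0 R | `|l - u n| <= e].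
  have Fn : F [set u : c0 R | u n \in `[- r n, r n]].
    by apply: filterS FK => u /(_ n); rewrite ler_norml /= in_itv.
  have [l [_ lc]] := @segment_compact _ (- r n) (r n) ((fun u : c0 R => u n) @ F) _ Fn.
  (* Along an ultrafilter a cluster point is a limit: otherwise the complement of the closed ball
     would belong to [F] without meeting the open ball. *)
  exists l => e e0; have [//|Fe] := in_ultra_setVsetC [set u : c0 R | `|l - u n| <= e] UF.
  have [|x [nlx]] := lc (~` [set x | `|l - x| <= e]) (ball l e) Fe.
    exact: nbhsx_ballx.
  by rewrite -ball_normE => /ltW/nlx.
have /choice[l lF] := near_l.
have lr n : `|l n| <= r n.
  apply/ler_addgt0Pr => e e0; have [u [ul uK]] := filter_ex (filterI (lF n e e0) FK).
  rewrite -(subrK (u n) (l n)); apply: le_trans (ler_normD _ _) _.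
  by rewrite addrC; apply: lerD; [exact: uK|exact: ul].
have l0 : l \in c0_pred (R := R) by apply/asboolP; exact: cvgr0_le lr r0.
exists (C0 l0); split=> //=; apply/cvgrPdist_le => e e0.
have e20 : 0 < e / 2 by rewrite divr_gt0.
have [N _ rN] := cvgr0_near r0 e20.
have FN : F [set u : c0 R | forall i : 'I_N, `|l i - u i| <= e].
  by apply: filter_forall => i; exact: lF.
apply: filterS (filterI FN FK) => u [uN uK]; apply: c0_norm_le => n.
rewrite -[X in `|X|]/(l n - u n).
have [nN|Nn] := ltnP n N; first exact: (uN (Ordinal nN)).
apply: le_trans (ler_normB _ _) _; rewrite (splitr e).
by apply: lerD; [apply: le_trans (lr n) _|apply: le_trans (uK n) _];
  exact: le_trans (ler_norm _) (rN n Nn).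
Qed.

(** The coordinate functionals are weak* null, so on a limited set their suprema [r n] tend to zero
    and form a compact envelope. *)
Lemma c0_gelfand_phillips : gelfand_phillips (c0 R).
Proof.
move=> A; split=> [|lA]; first exact: precompact_limited.
have /choice[f fE] := c0_coordinate.
have f0 : weak_star_null f by move=> u; under eq_fun do rewrite fE; exact: c0P.
pose r n := sup [set `|(f n u : R)| | u in A].
have cK := c0_dominated_compact (lA.2 f f0).
exists [set u : c0 R | forall n, `|u n| <= r n]; last first.
  by split=> //; apply: compact_closed cK; exact: norm_hausdorff.
move=> u Au n; rewrite -fE; apply: ub_le_sup; last by exists u.
have [M _ AM] := bounded_in_ex lA.1; exists M => _ [v Av <-].
by rewrite fE; apply: le_trans (c0_norm_ub v n) _; exact: AM.
Qed.

End limited_sets.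

(** * Disjointification of a bounded positive sequence *)

Section disjointification.
Variables (R : realType) (E : banachLatticeType R).
Implicit Types (x : nat -> E) (w : E).

(* The factor [4 ^+ k] separates term [k] from the earlier ones, and [w], chosen above
   all the [2^-1 ^+ i *: x i], separates it from the later ones. *)
Definition disjointify x w k : E :=
  vpos (x k - 4 ^+ k *: (\sum_(0 <= i < k) x i) - 2^-1 ^+ k *: w).

Lemma disjointify_le x w k : (forall i, vle 0 (x i)) -> vle 0 w ->
  vle (disjointify x w k) (x k).
Proof.
move=> x0 w0; apply: vpos_le => //; apply/vle_subl/vle_subl.
rewrite -addrA; apply: vleDr; apply: vaddr_ge0.
  by apply: vscaler_ge0; rewrite ?exprn_ge0.
by apply: vscaler_ge0; rewrite ?exprn_ge0//; apply: vsum_ge0.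
Qed.

(** Here [w] is the sum of the absolutely convergent series of the [2^-1 ^+ i *: x i]; it dominates
    each term because the positive cone is closed. *)
Lemma disjointify_disjoint x (M : R) :
  (forall k, vle 0 (x k)) -> (forall k, `|x k| <= M) ->
  exists2 w, vle 0 w &
    forall m k, m != k -> vmeet (disjointify x w m) (disjointify x w k) = 0.
Proof.
move=> x0 xM; pose y i := 2^-1 ^+ i *: x i.
have y0 i : vle 0 (y i) by apply: vscaler_ge0; rewrite ?exprn_ge0.
have /cvg_ex[w yw] : cvgn (series y).
  apply: normed_cvg; apply: nondecreasing_is_cvgn => [m n mn|].
    by apply: (@nondecreasing_series _ (fun i => `|y i|) xpredT).
  exists (2 * M) => _ [n _ <-].
  have M0 : 0 <= M by apply: le_trans (xM 0%N).
  apply: le_trans (ler_wpM2r M0 (geometric_half_le R n)); rewrite mulr_suml.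
  apply: ler_sum => i _; rewrite -[leLHS]/(`|2^-1 ^+ i *: x i|).
  rewrite normrZ ger0_norm ?exprn_ge0//.
  by rewrite ler_wpM2l ?exprn_ge0.
have yle i : vle (y i) w.
  apply/vsub_ge0; apply: (@vge0_closed _ _ (fun n => series y n - y i)).
    by apply: cvgB => //; exact: cvg_cst.
  exists i.+1 => // n /= ni; apply/vsub_ge0; rewrite /series /=.
  by apply: vle_sum_mem => //; rewrite mem_index_iota.
have w0 : vle 0 w by apply: vle_trans (yle 0%N); exact: y0.
exists w => //.
have lt_disjoint m k : (m < k)%N -> vmeet (disjointify x w m) (disjointify x w k) = 0.
  (* Term [m] is below the positive part of [d], since [2^-1 ^+ m *: w] dominates [4^-1 ^+ k *: x k]
     for [m < k]. Term [k] is below [4 ^+ k] times the negative part of [d], since the sum it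
     subtracts contains [x m]. *)
  move=> mk; pose d := x m - 4^-1 ^+ k *: x k.
  have vm : vle (disjointify x w m) (vpos d).
    apply: vpos_mono; apply: vleD.
      apply/vle_subl/vleDr/vscaler_ge0; first by rewrite exprn_ge0.
      exact: vsum_ge0.
    apply/vleN; apply: (@vle_trans _ _ (2^-1 ^+ m *: y k)); last first.
      by apply: vleZ; rewrite ?exprn_ge0.
    rewrite /y scalerA; apply: vler_wscale => //.
    have -> : 4^-1 = 2^-1 * 2^-1 :> R by field.
    rewrite exprMn ler_wpM2r ?exprn_ge0// ler_wiXn2l//; last exact: ltnW.
    lra.
  have vk : vle (disjointify x w k) (4 ^+ k *: vpos (- d)).
    rewrite -vposZ ?exprn_gt0//; apply: vpos_mono.
    rewrite opprB scalerBr scalerA -exprMn mulfV// expr1n scale1r.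
    apply: (@vle_trans _ _ (x k - 4 ^+ k *: (\sum_(0 <= i < k) x i))).
      by apply/vle_subl/vleDr/vscaler_ge0; rewrite ?exprn_ge0.
    apply/vleD2lE/vleN; apply: vleZ; first by rewrite exprn_ge0.
    by apply: vle_sum_mem; rewrite ?mem_index_iota.
  apply: vmeet_eq0_le (vpos_ge0 _) (vpos_ge0 _) vm vk _.
  rewrite vmeetC; apply: vmeet_eq0Z; rewrite ?exprn_ge0//; try exact: vpos_ge0.
  by rewrite vmeetC vpos_meetN.
move=> m k; rewrite neq_ltn => /orP[/lt_disjoint//|/lt_disjoint].
by rewrite vmeetC.
Qed.

End disjointification.

(** * The implications *)

Section implications.
Variables (R : realType) (E : banachLatticeType R).

(** A least upper bound is unique as a function, so quantifying over [g] amounts to speaking of the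
    moduli of the [f n]. *)
Definition weak_star_null_moduli := forall f : nat -> dual E, weak_star_null f ->
  L_sequence f /\
  exists g : nat -> dual E,
    (forall n, dual_modulus (f n) (g n)) /\ weak_star_null g.

Lemma weakly_null_disjointly_weakly_compact (x : nat -> E) :
  weakly_null x -> disjointly_weakly_compact (range x).
Proof.
move=> xn; split; first exact: weakly_null_bounded.
move=> w wS wd; apply: (weakly_null_solid wd xn) => j.
by have [_ [k _ <-] ?] := wS j; exists k.
Qed.

Lemma weak_star_null_dual_norm_bounded (f : nat -> dual E) :
  weak_star_null f -> [bounded dual_norm h | h in range f].
Proof.
move=> /weak_star_null_bounded[M M0 fM].
apply: (@bounded_in _ R^o _ _ _ M) => _ [n _ <-].
rewrite ger0_norm; last first.
  apply: (@le_trans _ _ `|(f n 0 : R)|) => //; apply: ub_le_sup.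
    exists M => _ [x /= x1 <-]; apply: le_trans (fM n x) _.
    by rewrite -[leRHS]mulr1 ler_wpM2l.
  by exists 0; rewrite //= normr0.
apply: ge_sup; first by exists `|(f n 0 : R)|, 0; rewrite //= normr0.
move=> _ [x /= x1 <-]; apply: le_trans (fM n x) _.
by rewrite -[leRHS]mulr1 ler_wpM2l.
Qed.

Lemma d_DPstar_weak_star_null_moduli : d_DPstar E -> weak_star_null_moduli.
Proof.
move=> DP f f0; split.
  split=> [|x xn]; first exact: weak_star_null_dual_norm_bounded.
  apply: (@sup_cvg0 _ _ (fun k (h : dual E) => h (x k))) => e e0.
  have lx := DP _ (weakly_null_disjointly_weakly_compact xn).
  (* For [n >= N] the estimate is uniform in [k] because the range of [x] is limited; the finitely
     many other [f n] are handled by weak nullity. *)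
  have [N _ fN] := limited_uniform lx f0 e0.
  have small : \forall k \near \oo, forall n : 'I_N, `|(f n (x k) : R)| <= e.
    by apply: filter_forall => n; exact: cvgr0_near (xn (f n)) e0.
  apply: filterS small => k fk _ [n _ <-].
  have [nN|Nn] := ltnP n N; first exact: (fk (Ordinal nN)).
  by apply: fN => //; exists k.
have /choice[g fg] := fun n => dual_modulus_exists (f n).
exists g; split=> //.
(* The order interval below [x] is limited, so [f n] is eventually at most [e / 3] on it, and
   [dual_modulus_le] multiplies this by 3. *)
have gpos x : vle 0 x -> g n x @[n --> \oo] --> (0 : R).
  move=> x0; apply/cvgr0Pnorm_le => e e0.
  have lx := DP _ (interval_disjointly_weakly_compact x0).
  have e30 : 0 < e / 3 by rewrite divr_gt0.
  apply: filterS (limited_uniform lx f0 e30) => n fn.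
  rewrite ger0_norm; last exact: (dual_modulus_ge0 (fg n)).
  apply: le_trans (dual_modulus_le (c := e / 3) (fg n) x0 _) _; last by lra.
  by move=> y y0 yx; apply: fn.
move=> x.
have -> : (fun n => g n x) = (fun n => (g n (vpos x) : R) - (g n (vpos (- x)) : R)).
  by apply/funext => n; rewrite -{1}(vposBN x) dualB.
by have := cvgB (gpos _ (vpos_ge0 x)) (gpos _ (vpos_ge0 (- x))); rewrite subr0; exact.
Qed.

Lemma weak_star_null_moduli_d_DPstar : weak_star_null_moduli -> d_DPstar E.
Proof.
move=> H A [bA Adis]; apply: uniform_limited => // f e f0 e0.
apply: contrapT => nbad.
have [[_ Lf] [g [fg g0]]] := H f f0.
have e40 : 0 < e / 4 by rewrite divr_gt0.
have e320 : 0 < e / 32 by rewrite divr_gt0.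
(* A pair consists of the index of a functional and a point of [A] where it exceeds [e]. The last
   clause makes the later correction by the earlier points, with the factor of [disjointify], cost
   at most [e / 4]. *)
pose P (s : seq (nat * E)) (t : nat * E) :=
  [/\ A t.2, e < `|(f t.1 t.2 : R)|, (size s <= t.1)%N
    & (g t.1 (4 ^+ size s *: \sum_(p <- s) vabs p.2) : R) <= e / 4].
have [u uP] : exists u : nat -> nat * E, forall k, P (mkseq u k) (u k).
  apply: greedy_sequence => s.
  have [N _ gN] := cvgr0_near (g0 (4 ^+ size s *: \sum_(p <- s) vabs p.2)) e40.
  apply: contrapT => nex; apply: nbad.
  exists (maxn N (size s)) => // n /=; rewrite geq_max => /andP[Nn sn] x Ax.
  rewrite leNgt; apply/negP => ex; apply: nex; exists (n, x); split=> //=.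
  exact: le_trans (ler_norm _) (gN n Nn).
pose x k := vabs (u k).2.
have Au k : A (u k).2 by case: (uP k).
have [M M0 AM] := bounded_in_ex bA.
have x0 k : vle 0 (x k) by exact: vabs_ge0.
have xM k : `|x k| <= M by rewrite norm_vabs; exact: AM.
have [w w0 vd] := disjointify_disjoint x0 xM.
have vx k := disjointify_le k x0 w0.
have v0 k : vle 0 (disjointify x w k) by exact: vpos_ge0.
(* The disjointified terms are large for the moduli; the witnesses [z k] below them carry this back
   to the [f n] themselves, and remain disjoint and in [Sol A]. *)
have /choice[z zP] := fun k => dual_modulus_witness (fg (u k).1) (v0 k).
have z0 k : vle 0 (z k) by case: (zP k).
have zdis : disjoint_seq z.
  move=> m k mk; rewrite !vabs_id//; apply: vmeet_eq0_le (vd m k mk) => //.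
    by case: (zP m).
  by case: (zP k).
have zS k : Sol A (z k).
  exists (u k).2 => //; rewrite (vabs_id (z0 k)); apply: vle_trans (vx k).
  by case: (zP k).
have [F F0 fF] := weak_star_null_bounded f0.
have zn := Lf z (Adis z zS zdis).
have [|N1 _ fz] := @cvg0_sup _ _ (fun k (h : dual E) => h (z k)) _ _ zn _ e320.
  by move=> k; exists (F * `|z k|) => _ [n _ <-]; exact: fF.
have [N2 _ gw] := cvgr0_near (g0 w) e40.
(* [N1] makes every functional small at [z k], including the one whose index depends on [k]. [N2]
   makes the modulus small at [w], because the chosen index is at least [k]. *)
pose k := maxn N1 N2; have [_ + + gs] := uP k; rewrite !size_mkseq in gs *.
move=> ek ku.
have fzk : `|(f (u k).1 (z k) : R)| <= e / 32.
  by apply: fz; rewrite /= ?leq_maxl//; exists (u k).1.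
have gwk : `|(g (u k).1 w : R)| <= e / 4.
  by apply: gw => /=; apply: leq_trans ku; exact: leq_maxr.
have [_ _ gv] := zP k.
have fx := dual_modulus_abs (fg (u k).1) (u k).2.
have wk : (g (u k).1 (2^-1 ^+ k *: w) : R) <= g (u k).1 w.
  rewrite -{2}(scale1r w); apply: (dual_modulus_mono (fg _)); apply: vler_wscale => //.
  by rewrite exprn_ile1//; lra.
(* The three summands contribute at most [4 * (e / 32)], [e / 4] and [e / 4], in total less than
   [e], whereas the left side exceeds [e]. *)
have : (g (u k).1 (x k) : R) <=
    g (u k).1 (disjointify x w k + 4 ^+ k *: (\sum_(0 <= i < k) x i) + 2^-1 ^+ k *: w).
  apply: (dual_modulus_mono (fg _)); apply: (vle_subl _ _ _).1; apply: (vle_subl _ _ _).1.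
  by rewrite addrAC; exact: vle_vpos.
rewrite !dualD; move: gs; rewrite big_map /index_iota subn0 -/(index_iota 0 k).
move: (ler_norm (g (u k).1 w : R)); lra.
Qed.

Lemma d_DPstar_DW_compact (Y : completeNormedModType R) (T : bounded_linear E Y) :
  d_DPstar E -> gelfand_phillips Y -> DW_compact T.
Proof. by move=> DP GP A /DP lA; apply/GP; exact: limited_image. Qed.

Lemma DW_compact_c0_d_DPstar :
  (forall T : bounded_linear E (c0 R), DW_compact T) -> d_DPstar E.
Proof.
move=> H A dA; apply: uniform_limited => [|f e f0 e0]; first exact: dA.1.
have [M M0 fM] := weak_star_null_bounded f0.
have fc x : (fun n => f n x : R) \in c0_pred (R := R) by apply/asboolP; exact: f0.
have [T TE] : exists T : bounded_linear E (c0 R), forall x, T x = C0 (fc x).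
  apply: (@mk_bounded_linear _ E (c0 R) (fun x => C0 (fc x)) M) => [x y|a x|x].
  - by apply/val_inj/funext => n; exact: dualD.
  - by apply/val_inj/funext => n; exact: dualZ.
  - by apply: c0_norm_le => n; exact: fM.
have /choice[p pE] := c0_coordinate R.
have p0 : weak_star_null p by move=> v; under eq_fun do rewrite pE; exact: c0P.
(* The image of [A] is limited in [c0], and its coordinates are the values of the [f n] on [A]. *)
have lT := precompact_limited (H T A dA).
apply: filterS (limited_uniform lT p0 e0) => n pn x Ax.
by have := pn _ (ex_intro2 _ _ x Ax erefl); rewrite pE TE.
Qed.

End implications.

Theorem proposition3p2 (R : realType) (E : banachLatticeType R) :
  [<-> d_DPstar E;
       forall f : nat -> dual E, weak_star_null f ->
         L_sequence f /\
         exists g : nat -> dual E,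
           (forall n, dual_modulus (f n) (g n)) /\ weak_star_null g;
       forall Y : completeNormedModType R, gelfand_phillips Y ->
         forall T : bounded_linear E Y, DW_compact T;
       forall T : bounded_linear E (c0 R), DW_compact T].
Proof.
tfae.
- exact: d_DPstar_weak_star_null_moduli.
- by move=> /weak_star_null_moduli_d_DPstar DP Y GP T; exact: d_DPstar_DW_compact.
- by move=> GP; apply: GP; exact: c0_gelfand_phillips.
- exact: DW_compact_c0_d_DPstar.
Qed.
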